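(* Let $\Bbbk$ be an algebraically closed field, $G$ an abelian group with $\Bbbk$-character group $\hat G=\mathrm{Hom}(G,\Bbbk^\times)$, and let $A$ and $B$ be finite dimensional unital associative $G$-graded $\Bbbk$-algebras. If $A$ and $B$ are strongly gradable derived equivalent, then $\mathcal{Z}^G(A)\cong\mathcal{Z}^G(B)$ as $G\times\hat G$-graded algebras; that is, there is an isomorphism of $G$-graded algebras $\mathcal{Z}^G(A)\to\mathcal{Z}^G(B)$ which maps $\mathcal{Z}^G(A)_{g,\chi}$ onto $\mathcal{Z}^G(B)_{g,\chi}$ for all $g\in G$ and $\chi\in\hat G$.
   Context: $G$ is written additively. $A\text{-gmod}$ is the category of finite dimensional $G$-graded left $A$-modules with degree-preserving $A$-linear maps. The shift functor $\Pi_g$ on $A\text{-gmod}$ is given by $(\Pi_gM)_h=M_{h+g}$ (identity on underlying modules and maps); it is exact and induces a functor, also denoted $\Pi_g$, on $\mathcal{D}^b(A\text{-gmod})$; $\Pi_g\Pi_h=\Pi_{g+h}$, $\Pi_0=\mathrm{Id}$. A ($\Bbbk$-linear, additive) functor $K:\mathcal{D}^b(A\text{-gmod})\to\mathcal{D}^b(B\text{-gmod})$ is graded if it intertwines the $G$-actions $\Pi$, i.e. there are natural transformations $\xi^g:K\circ\Pi_g\Rightarrow\Pi_g\circ K$, $g\in G$, with $\xi^0=\mathrm{Id}_K$ and $\Pi_k(\xi^h)\circ\xi^k_{\Pi_h}=\xi^{k+h}$ for all $h,k\in G$. A gradable derived equivalence between $A$ and $B$ is a graded and triangulated functor $F:\mathcal{D}^b(A\text{-gmod})\to\mathcal{D}^b(B\text{-gmod})$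 which admits an inverse which is also graded and triangulated. It is strong if both $F({}_AA)$ and $F^{-1}({}_BB)$ are quasi-isomorphic to complexes concentrated in one (cohomological) degree. $A$ and $B$ are strongly gradable derived equivalent if there is a strong gradable derived equivalence between them. $\Bbbk^G$ is the algebra of all functions $G\to\Bbbk$; $A\otimes\Bbbk^G=\mathrm{Hom}_{\mathbf{Set}}(G,A)$ has pointwise multiplication, elements $\mathbf{x}:g\mapsto x^{(g)}$, and $G$-grading $(A\otimes\Bbbk^G)_g=A_g\otimes\Bbbk^G$. The $G$-centre is the $G$-graded subalgebra $$\mathcal{Z}^G(A)=\{\mathbf{x}\in A\otimes\Bbbk^G\mid x^{(g)}y=yx^{(g+h)}\text{ for all } g,h\in G,\ y\in A_h\}.$$ For $g\in G$ and $\chi\in\hat G$, put $\mathcal{Z}^G(A)_{\chi}=\{\mathbf{x}\in\mathcal{Z}^G(A)\mid x^{(k)}=\chi(k)x^{(0)}\ \forall k\in G\}$ and $\mathcal{Z}^G(A)_{g,\chi}=\mathcal{Z}^G(A)_g\cap\mathcal{Z}^G(A)_\chi$. (When $|G|$ is finite and not divisible by $\mathrm{char}(\Bbbk)$, these give a $G\times\hat G$-grading of $\mathcal{Z}^G(A)$.) *)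

(* Defs.v *)
From HB Require Import structures.
From mathcomp Require Import all_boot all_order all_algebra all_field.
From mathcomp Require Import boolp classical_sets functions.

Set Implicit Arguments.
Unset Strict Implicit.
Unset Printing Implicit Defensive.

Import Order.TTheory GRing.Theory Num.Theory.
Local Open Scope ring_scope.
Local Obligation Tactic := idtac.

Section LinearMaps.
Variables (k : fieldType) (U V : vectType k).

Definition lfun_of (f : U -> V) (fL : linear f) : 'Hom(U, V) :=
  let m := GRing.isLinear.Build k U V *:%R f fL in
  let f' : {linear U -> V} := HB.pack f m in linfun f'.

Lemma lfun_ofE (f : U -> V) (fL : linear f) u : lfun_of fL u = f u.
Proof. by rewrite /lfun_of lfunE. Qed.

End LinearMaps.

Section Gradings.
Variables (k : fieldType) (G : zmodType).

(* V is the internal direct sum of the V_ g; as V is finite dimensional, the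
   span condition only ever involves finitely many g, even if G is infinite. *)
Record is_grading (V : vectType k) (V_ : G -> {vspace V}) : Prop := IsGrading {
  grading_span : exists s : seq G, (\sum_(g <- s) V_ g)%VS = fullv;
  grading_indep : forall (s : seq G) (v : G -> V), uniq s ->
    (forall g, v g \in V_ g) -> \sum_(g <- s) v g = 0 ->
    forall g, g \in s -> v g = 0
}.

Record galg := GAlg {
  galg_sort :> falgType k;
  ahom_part : G -> {vspace galg_sort};
  galg_grading : is_grading ahom_part;
  (* implied by the other axioms *)
  galg_one : 1 \in ahom_part 0;
  galg_mul : forall g h a b, a \in ahom_part g -> b \in ahom_part h ->
    a * b \in ahom_part (g + h)
}.

Record gmod (A : galg) := GMod {
  gmod_sort :> vectType k;
  act : A -> gmod_sort -> gmod_sort;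
  hom_part : G -> {vspace gmod_sort};
  act_linearl : forall m, linear (act^~ m);
  act_linearr : forall a, linear (act a);
  act_one : forall m, act 1 m = m;
  act_mul : forall a b m, act (a * b) m = act a (act b m);
  gmod_grading : is_grading hom_part;
  act_grade : forall h g a m, a \in ahom_part A h -> m \in hom_part g ->
    act a m \in hom_part (h + g)
}.

End Gradings.

Arguments ahom_part {k G} A g : rename.
Arguments hom_part {k G A} M g : rename.
Arguments act {k G A M} a m : rename.

Section GradedModules.
Variables (k : fieldType) (G : zmodType) (A : galg k G).
Implicit Types M N P : gmod A.

Record is_gmor M N (f : 'Hom(M, N)) : Prop := IsGMor {
  gmor_act : forall a m, f (act a m) = act a (f m);
  gmor_grade : forall g m, m \in hom_part M g -> f m \in hom_part N g
}.

Lemma gmor_id M : is_gmor (\1%VF : 'Hom(M, M)).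
Proof. by split=> [a m|g m]; rewrite !lfunE. Qed.

Lemma gmor_comp M N P (f : 'Hom(M, N)) (g : 'Hom(N, P)) :
  is_gmor f -> is_gmor g -> is_gmor (g \o f)%VF.
Proof.
move=> [fa fg] [ga gg]; split=> [a m|h m mM]; rewrite !comp_lfunE.
  by rewrite fa ga.
exact/gg/fg.
Qed.

Lemma act0 M (a : A) : act a (0 : M) = 0.
Proof.
have := @act_linearr _ _ _ M a (- 1) 0 0.
by rewrite scaler0 addr0 scaleN1r addNr.
Qed.

Lemma gmor_zero M N : is_gmor (0 : 'Hom(M, N)).
Proof. by split=> [a m|g m _]; rewrite !lfunE /= ?act0 ?mem0v. Qed.

Lemma gmor_lin M N (c : k) (f g : 'Hom(M, N)) :
  is_gmor f -> is_gmor g -> is_gmor (c *: f + g).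
Proof.
move=> [fa fg] [ga gg]; split=> [a m|h m mM].
  by rewrite !lfunE /= !lfunE /= fa ga act_linearr.
by rewrite !lfunE /= !lfunE /= memvD ?memvZ ?fg ?gg.
Qed.

Lemma gmor_add M N (f g : 'Hom(M, N)) :
  is_gmor f -> is_gmor g -> is_gmor (f + g).
Proof. by move=> fM /(gmor_lin 1 fM); rewrite scale1r. Qed.

Lemma gmor_scale M N (c : k) (f : 'Hom(M, N)) : is_gmor f -> is_gmor (c *: f).
Proof. by move=> fM; rewrite -[_ *: _]addr0; apply: gmor_lin => //; apply: gmor_zero. Qed.

Definition zero_vect : vectType k := 'rV[k]_0.

Lemma zero_vect0 (x : zero_vect) : x = 0.
Proof. by apply/rowP => -[]. Qed.

Program Definition gmod0 : gmod A :=
  @GMod k G A zero_vect (fun _ m => m) (fun _ => fullv) _ _ _ _ _ _.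
Next Obligation. by move=> m c x y; rewrite [LHS]zero_vect0 [RHS]zero_vect0. Qed.
Next Obligation. by []. Qed.
Next Obligation. by []. Qed.
Next Obligation. by []. Qed.
Next Obligation.
split=> [|s v _ _ _ g _]; last by rewrite [LHS]zero_vect0.
by exists [:: 0]; rewrite big_seq1.
Qed.
Next Obligation. by move=> *; rewrite memvf. Qed.

(* A as a left module over itself *)
Program Definition regular : gmod A :=
  @GMod k G A A (fun a m => a * m) (ahom_part A) _ _ _ _ _ _.
Next Obligation. by move=> m c x y; rewrite mulrDl scalerAl. Qed.
Next Obligation. by move=> a c x y; rewrite mulrDr scalerAr. Qed.
Next Obligation. exact: mul1r. Qed.
Next Obligation. by move=> a b m /=; rewrite mulrA. Qed.
Next Obligation. exact: galg_grading. Qed.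
Next Obligation. move=> h g a m; exact: galg_mul. Qed.

(* Pi_g M : same module, with (Pi_g M)_h = M_(h + g) *)
Program Definition gshift (g : G) M : gmod A :=
  @GMod k G A M act (fun h => hom_part M (h + g)) _ _ _ _ _ _.
Next Obligation. by move=> g M m; apply: act_linearl. Qed.
Next Obligation. by move=> g M a; apply: act_linearr. Qed.
Next Obligation. by move=> g M m; apply: act_one. Qed.
Next Obligation. by move=> g M a b m; apply: act_mul. Qed.
Next Obligation.
move=> g M; have [[s sE] ind] := gmod_grading M; split.
  exists [seq h - g | h <- s]; rewrite big_map -[RHS]sE.
  by apply: eq_bigr => h _; rewrite subrK.
move=> t v tU vM v0 h ht.
have := ind [seq h + g | h <- t] (fun h => v (h - g)).
rewrite map_inj_uniq //; last exact: addIr.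
rewrite big_map (eq_bigr v); last by move=> i _; rewrite addrK.
move=> /(_ tU) H; have := H _ v0 (h + g).
rewrite addrK; apply; last exact: map_f.
by move=> i; have := vM (i - g); rewrite subrK.
Qed.
Next Obligation.
by move=> g M h l a m aA mM /=; rewrite -addrA; apply: act_grade.
Qed.

Lemma gmor_gshift g M N (f : 'Hom(M, N)) :
  is_gmor f -> @is_gmor (gshift g M) (gshift g N) f.
Proof. by move=> [fa fg]; split=> // h m; apply: fg. Qed.

Section DirectSum.
Variables M N : gmod A.

Fact inl_linear : linear (fun m : M => (m, 0) : M * N).
Proof. by move=> c x y; congr pair; rewrite /= scaler0 addr0. Qed.
Fact inr_linear : linear (fun n : N => (0, n) : M * N).
Proof. by move=> c x y; congr pair; rewrite /= scaler0 addr0. Qed.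
Fact prl_linear : linear (fun p : M * N => p.1).
Proof. by []. Qed.
Fact prr_linear : linear (fun p : M * N => p.2).
Proof. by []. Qed.

Definition linl : 'Hom(M, (M * N)%type) := lfun_of inl_linear.
Definition linr : 'Hom(N, (M * N)%type) := lfun_of inr_linear.
Definition lprl : 'Hom((M * N)%type, M) := lfun_of prl_linear.
Definition lprr : 'Hom((M * N)%type, N) := lfun_of prr_linear.

Definition dsum_part (g : G) : {vspace (M * N)%type} :=
  (lprl @^-1: hom_part M g :&: lprr @^-1: hom_part N g)%VS.

Lemma mem_dsum_part g (p : M * N) :
  (p \in dsum_part g) = (p.1 \in hom_part M g) && (p.2 \in hom_part N g).
Proof. by rewrite memv_cap -!memv_preim !lfun_ofE. Qed.

Lemma dsum_grading : is_grading dsum_part.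
Proof.
have [[s sE] indM] := gmod_grading M; have [[t tE] indN] := gmod_grading N.
split.
  exists (s ++ t); apply/eqP; rewrite eqEsubv subvf /=.
  apply/subvP => -[m n] _.
  have -> : (m, n) = linl m + linr n.
    by rewrite !lfun_ofE; congr pair; rewrite ?addr0 ?add0r.
  rewrite big_cat /=; apply: memv_add.
    have : linl m \in (linl @: \sum_(g <- s) hom_part M g)%VS.
      by rewrite memv_img // sE memvf.
    rewrite limg_sum; apply/subvP/(big_ind2 (fun U V => (U <= V)%VS)) => //.
      by move=> ? ? ? ?; apply: addvS.
    move=> g _; apply/subvP => _ /memv_imgP[x xM ->].
    by rewrite mem_dsum_part !lfun_ofE /= xM mem0v.
  have : linr n \in (linr @: \sum_(g <- t) hom_part N g)%VS.
    by rewrite memv_img // tE memvf.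
  rewrite limg_sum; apply/subvP/(big_ind2 (fun U V => (U <= V)%VS)) => //.
    by move=> ? ? ? ?; apply: addvS.
  move=> g _; apply/subvP => _ /memv_imgP[x xM ->].
  by rewrite mem_dsum_part !lfun_ofE /= xM mem0v.
move=> u v uU vP v0 g gu.
have vM h : lprl (v h) \in hom_part M h.
  by have := vP h; rewrite mem_dsum_part lfun_ofE => /andP[].
have vN h : lprr (v h) \in hom_part N h.
  by have := vP h; rewrite mem_dsum_part lfun_ofE => /andP[].
have := indM u (fun h => lprl (v h)) uU vM.
rewrite -linear_sum v0 linear0 => /(_ erefl _ gu) v1.
have := indN u (fun h => lprr (v h)) uU vN.
rewrite -linear_sum v0 linear0 => /(_ erefl _ gu) v2.
by move: v1 v2; rewrite !lfun_ofE; case: (v g) => ? ? /= -> ->.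
Qed.

Program Definition dsum : gmod A :=
  @GMod k G A (M * N)%type (fun a p => (act a p.1, act a p.2)) dsum_part
    _ _ _ _ dsum_grading _.
Next Obligation. by move=> m c x y; rewrite !act_linearl. Qed.
Next Obligation. by move=> a c x y; rewrite /= !act_linearr. Qed.
Next Obligation. by move=> [m n]; rewrite !act_one. Qed.
Next Obligation. by move=> a b m; rewrite /= !act_mul. Qed.
Next Obligation.
move=> h g a m aA; rewrite !mem_dsum_part => /andP[mM mN] /=.
by rewrite !act_grade.
Qed.

Lemma gmor_linl : @is_gmor M dsum linl.
Proof.
split=> [a m|g m mM]; rewrite !lfun_ofE /= ?act0 //.
by rewrite mem_dsum_part /= mM mem0v.
Qed.

Lemma gmor_linr : @is_gmor N dsum linr.
Proof.
split=> [a m|g m mM]; rewrite !lfun_ofE /= ?act0 //.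
by rewrite mem_dsum_part /= mM mem0v.
Qed.

Lemma gmor_lprl : @is_gmor dsum M lprl.
Proof.
split=> [a m|g m]; first by rewrite !lfun_ofE.
by rewrite mem_dsum_part lfun_ofE => /andP[].
Qed.

Lemma gmor_lprr : @is_gmor dsum N lprr.
Proof.
split=> [a m|g m]; first by rewrite !lfun_ofE.
by rewrite mem_dsum_part lfun_ofE => /andP[].
Qed.

End DirectSum.

(* Bounded (cochain) complexes over A-gmod *)
Record cplx := Cplx {
  term :> int -> gmod A;
  diff : forall i, 'Hom(term i, term (i + 1));
  diff_gmor : forall i, is_gmor (diff i);
  diff_diff : forall i x, diff (i + 1) (diff i x) = 0;
  cplx_bounded : exists a b : int, forall i, (i < a) || (b < i) ->
    forall x : term i, x = 0
}.

Record chain (X Y : cplx) := Chain {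
  chain_map :> forall i, 'Hom(X i, Y i);
  chain_gmor : forall i, is_gmor (chain_map i);
  chain_diff : forall i x,
    chain_map (i + 1) (diff X i x) = diff Y i (chain_map i x)
}.

End GradedModules.

Arguments linl {k G A} M N.
Arguments linr {k G A} M N.
Arguments lprl {k G A} M N.
Arguments lprr {k G A} M N.
Arguments term {k G A} X i : rename.
Arguments diff {k G A} X i : rename.

Section Complexes.
Variables (k : fieldType) (G : zmodType) (A : galg k G).
Implicit Types X Y Z W : cplx A.

Definition chain_eq X Y (f g : chain X Y) : Prop := forall i, f i = g i.

Program Definition cid X : chain X X := @Chain _ _ _ X X (fun i => \1%VF) _ _.
Next Obligation. by move=> X i; apply: gmor_id. Qed.
Next Obligation. by move=> X i x; rewrite !lfunE. Qed.

Program Definition ccomp X Y Z (g : chain Y Z) (f : chain X Y) : chain X Z :=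
  @Chain _ _ _ X Z (fun i => (g i \o f i)%VF) _ _.
Next Obligation. by move=> *; apply: gmor_comp; apply: chain_gmor. Qed.
Next Obligation. by move=> *; rewrite !comp_lfunE !chain_diff. Qed.

Program Definition czero X Y : chain X Y := @Chain _ _ _ X Y (fun i => 0) _ _.
Next Obligation. by move=> *; apply: gmor_zero. Qed.
Next Obligation. by move=> *; rewrite !lfunE linear0. Qed.

Program Definition cadd X Y (f g : chain X Y) : chain X Y :=
  @Chain _ _ _ X Y (fun i => f i + g i) _ _.
Next Obligation. by move=> *; apply: gmor_add; apply: chain_gmor. Qed.
Next Obligation. by move=> *; rewrite !lfunE /= !chain_diff linearD. Qed.

Program Definition cscale X Y (c : k) (f : chain X Y) : chain X Y :=
  @Chain _ _ _ X Y (fun i => c *: f i) _ _.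
Next Obligation. by move=> *; apply: gmor_scale; apply: chain_gmor. Qed.
Next Obligation. by move=> *; rewrite !lfunE /= !chain_diff linearZ. Qed.

(* f induces isomorphisms (injective, then surjective) between the cohomology
   spaces ker d^(i+1) / im d^i, for all i : int, hence in all degrees. *)
Definition qis X Y (f : chain X Y) : Prop := forall i,
  (forall x : X (i + 1), diff X (i + 1) x = 0 ->
     (exists y, f (i + 1) x = diff Y i y) -> exists x', x = diff X i x') /\
  (forall y : Y (i + 1), diff Y (i + 1) y = 0 ->
     exists2 x, diff X (i + 1) x = 0 &
       exists y', y = f (i + 1) x + diff Y i y').

Inductive quasi_isomorphic : cplx A -> cplx A -> Prop :=
| qi_refl X : quasi_isomorphic X X
| qi_left X Y Z (s : chain X Y) :
    qis s -> quasi_isomorphic Y Z -> quasi_isomorphic X Z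
| qi_right X Y Z (s : chain Y X) :
    qis s -> quasi_isomorphic Y Z -> quasi_isomorphic X Z.

Definition concentrated_in (n : int) X : Prop :=
  forall i, i != n -> forall x : X i, x = 0.

Program Definition stalk (M : gmod A) : cplx A :=
  @Cplx _ _ _ (fun i => if i == 0 then M else gmod0 A) (fun i => 0) _ _ _.
Next Obligation. by move=> *; apply: gmor_zero. Qed.
Next Obligation. by move=> *; rewrite lfunE. Qed.
Next Obligation.
move=> M; exists 0, 0 => i; rewrite -neq_lt.
by case: eqP => // _ _ x; apply: zero_vect0.
Qed.

Program Definition Pi_cplx (g : G) X : cplx A :=
  @Cplx _ _ _ (fun i => gshift g (X i)) (fun i => diff X i) _ _ _.
Next Obligation. by move=> *; apply/gmor_gshift/diff_gmor. Qed.
Next Obligation. by move=> *; apply: diff_diff. Qed.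
Next Obligation. by move=> g X; apply: cplx_bounded. Qed.

Program Definition Pi_chain g X Y (f : chain X Y) :
    chain (Pi_cplx g X) (Pi_cplx g Y) :=
  @Chain _ _ _ (Pi_cplx g X) (Pi_cplx g Y) (fun i => f i) _ _.
Next Obligation. by move=> *; apply/gmor_gshift/chain_gmor. Qed.
Next Obligation. by move=> g X Y f i x; exact: (chain_diff f x). Qed.

(* X[1] *)
Program Definition sh_cplx X : cplx A :=
  @Cplx _ _ _ (fun i => X (i + 1)) (fun i => - diff X (i + 1)) _ _ _.
Next Obligation.
by move=> X i; rewrite /= -scaleN1r; apply/gmor_scale/diff_gmor.
Qed.
Next Obligation. by move=> X i x; rewrite !opp_lfunE linearN opprK; apply: diff_diff. Qed.
Next Obligation.
move=> X; have [a [b ab]] := cplx_bounded X; exists (a - 1), (b - 1) => i.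
by rewrite ltrBrDr ltrBlDr; apply: ab.
Qed.

Program Definition sh_chain X Y (f : chain X Y) :
    chain (sh_cplx X) (sh_cplx Y) :=
  @Chain _ _ _ (sh_cplx X) (sh_cplx Y) (fun i => f (i + 1)) _ _.
Next Obligation. by move=> X Y f i; apply: (chain_gmor f (i + 1)). Qed.
Next Obligation.
move=> X Y f i x; rewrite /= !opp_lfunE linearN; congr (- _).
exact: (chain_diff f).
Qed.

(* Mapping cone: X^(i+1) (+) Y^i, with d (x, y) = (- d x, f x + d y) *)
Definition cone_diff X Y (f : chain X Y) (i : int) :
    'Hom(dsum (X (i + 1)) (Y i), dsum (X (i + 1 + 1)) (Y (i + 1))) :=
  ((linl (X (i + 1 + 1)) (Y (i + 1)) \o
      ((- diff X (i + 1)) \o lprl (X (i + 1)) (Y i))) +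
   (linr (X (i + 1 + 1)) (Y (i + 1)) \o
      ((f (i + 1) \o lprl (X (i + 1)) (Y i)) +
       (diff Y i \o lprr (X (i + 1)) (Y i)))))%VF.

Lemma cone_diffE X Y (f : chain X Y) i p :
  cone_diff f i p = (- diff X (i + 1) p.1, f (i + 1) p.1 + diff Y i p.2).
Proof.
rewrite /cone_diff !(add_lfunE, comp_lfunE, opp_lfunE, lfun_ofE).
by congr pair; rewrite /= ?addr0 ?add0r.
Qed.

Program Definition cone X Y (f : chain X Y) : cplx A :=
  @Cplx _ _ _ (fun i => dsum (X (i + 1)) (Y i)) (cone_diff f) _ _ _.
Next Obligation.
move=> X Y f i; apply: gmor_add.
  apply: gmor_comp (gmor_linl _ _); apply: gmor_comp (gmor_lprl _ _) _.
  by rewrite -scaleN1r; apply/gmor_scale/diff_gmor.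
apply: gmor_comp (gmor_linr _ _); apply: gmor_add.
  exact: gmor_comp (gmor_lprl _ _) (chain_gmor _ _).
exact: gmor_comp (gmor_lprr _ _) (diff_gmor _ _).
Qed.
Next Obligation.
move=> X Y f i p; rewrite !cone_diffE /=; congr pair.
  by rewrite linearN opprK; apply: diff_diff.
rewrite linearN linearD.
transitivity (- diff Y (i + 1) (f (i + 1) p.1)
              + (diff Y (i + 1) (f (i + 1) p.1) + 0)).
  congr (- _ + (_ + _)); [exact: (chain_diff f) | exact: diff_diff].
by rewrite addr0 addNr.
Qed.
Next Obligation.
move=> X Y f; have [a [b abX]] := cplx_bounded X.
have [c [e ceY]] := cplx_bounded Y.
exists (Num.min (a - 1) c), (Num.max (b - 1) e) => i iP [x y].
have {}iP : (i + 1 < a) && (i < c) || (b < i + 1) && (e < i).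
  by move: iP; rewrite lt_min gt_max ltrBrDr ltrBlDr.
congr pair; [apply: abX | apply: ceY].
  by case/orP: iP => /andP[-> _]; rewrite ?orbT.
by case/orP: iP => /andP[_ ->]; rewrite ?orbT.
Qed.

Program Definition cone_in X Y (f : chain X Y) : chain Y (cone f) :=
  @Chain _ _ _ Y (cone f) (fun i => linr (X (i + 1)) (Y i)) _ _.
Next Obligation. by move=> *; apply: gmor_linr. Qed.
Next Obligation.
move=> X Y f i y; rewrite /= cone_diffE !lfun_ofE /=.
by congr pair; rewrite /= ?linear0 ?oppr0 ?add0r.
Qed.

Program Definition cone_out X Y (f : chain X Y) : chain (cone f) (sh_cplx X) :=
  @Chain _ _ _ (cone f) (sh_cplx X) (fun i => lprl (X (i + 1)) (Y i)) _ _.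
Next Obligation. by move=> *; apply: gmor_lprl. Qed.
Next Obligation.
by move=> X Y f i p; rewrite /= cone_diffE opp_lfunE !lfun_ofE.
Qed.

(* Pi_0 = Id and Pi_g Pi_h = Pi_(g + h) hold on the nose (up to propositional
   equality of index functions); these chain maps, which are the identity on
   the underlying spaces, stand for the transports along these equalities. *)
Program Definition Pi0 X : chain (Pi_cplx 0 X) X :=
  @Chain _ _ _ (Pi_cplx 0 X) X (fun i => \1%VF) _ _.
Next Obligation.
move=> X i; split=> [a m|g m]; rewrite !lfunE //=.
by rewrite addr0.
Qed.
Next Obligation. by move=> *; rewrite !lfunE. Qed.

Program Definition PiD g h X :
    chain (Pi_cplx g (Pi_cplx h X)) (Pi_cplx (g + h) X) :=
  @Chain _ _ _ (Pi_cplx g (Pi_cplx h X)) (Pi_cplx (g + h) X)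
    (fun i => \1%VF) _ _.
Next Obligation.
move=> g h X i; split=> [a m|l m]; rewrite !lfunE //=.
by rewrite addrA.
Qed.
Next Obligation. by move=> *; rewrite !lfunE. Qed.

Lemma qis_Pi g X Y (f : chain X Y) : qis f -> qis (Pi_chain g f).
Proof. by []. Qed.

Lemma qis_sh X Y (f : chain X Y) : qis f -> qis (sh_chain f).
Proof.
move=> fq i; have [inj sur] := fq (i + 1); split=> /=.
  move=> x; rewrite opp_lfunE => /eqP; rewrite oppr_eq0 => /eqP dx [y fx].
  have [|x' ->] := inj x dx; first by exists (- y); rewrite fx opp_lfunE linearN.
  by exists (- x'); rewrite opp_lfunE linearN opprK.
move=> y; rewrite opp_lfunE => /eqP; rewrite oppr_eq0 => /eqP dy.
have [x dx [y' ->]] := sur y dy; exists x; first by rewrite opp_lfunE dx oppr0.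
by exists (- y'); rewrite opp_lfunE linearN opprK.
Qed.

(* D^b(A-gmod) is the localisation of the category of bounded complexes at
   the quasi-isomorphisms. Its morphisms are presented as formal k-linear
   composites of chain maps and formal inverses of quasi-isomorphisms, modulo
   the congruence [dequiv] generated by the axioms of k-linear categories, the
   k-linear functoriality of [Qd], and the inversion of quasi-isomorphisms.
   As chain maps form a k-linear category, this is the localisation in the
   usual sense; in particular homotopic maps are identified. *)
Inductive dhom : cplx A -> cplx A -> Type :=
| Qd X Y : chain X Y -> dhom X Y
| dinv X Y (s : chain X Y) : qis s -> dhom Y X
| dcomp X Y Z : dhom Y Z -> dhom X Y -> dhom X Z
| dadd X Y : dhom X Y -> dhom X Y -> dhom X Y
| dscale X Y : k -> dhom X Y -> dhom X Y.

Definition did X : dhom X X := Qd (cid X).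

Reserved Notation "e ~= e'" (at level 70, no associativity).

Inductive dequiv : forall X Y, dhom X Y -> dhom X Y -> Prop :=
| de_refl X Y (e : dhom X Y) : e ~= e
| de_sym X Y (e e' : dhom X Y) : e ~= e' -> e' ~= e
| de_trans X Y (e e' e'' : dhom X Y) : e ~= e' -> e' ~= e'' -> e ~= e''
| de_comp X Y Z (e1 e1' : dhom Y Z) (e2 e2' : dhom X Y) :
    e1 ~= e1' -> e2 ~= e2' -> dcomp e1 e2 ~= dcomp e1' e2'
| de_add X Y (e1 e1' e2 e2' : dhom X Y) :
    e1 ~= e1' -> e2 ~= e2' -> dadd e1 e2 ~= dadd e1' e2'
| de_scale X Y c (e e' : dhom X Y) : e ~= e' -> dscale c e ~= dscale c e'
| de_compA X Y Z W (e1 : dhom Z W) (e2 : dhom Y Z) (e3 : dhom X Y) :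
    dcomp e1 (dcomp e2 e3) ~= dcomp (dcomp e1 e2) e3
| de_id_comp X Y (e : dhom X Y) : dcomp (did Y) e ~= e
| de_comp_id X Y (e : dhom X Y) : dcomp e (did X) ~= e
| de_addA X Y (e1 e2 e3 : dhom X Y) :
    dadd e1 (dadd e2 e3) ~= dadd (dadd e1 e2) e3
| de_addC X Y (e1 e2 : dhom X Y) : dadd e1 e2 ~= dadd e2 e1
| de_add0 X Y (e : dhom X Y) : dadd (Qd (czero X Y)) e ~= e
| de_addN X Y (e : dhom X Y) : dadd (dscale (- 1) e) e ~= Qd (czero X Y)
| de_scaleA X Y a b (e : dhom X Y) : dscale a (dscale b e) ~= dscale (a * b) e
| de_scale1 X Y (e : dhom X Y) : dscale 1 e ~= e
| de_scaleDr X Y a (e1 e2 : dhom X Y) :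
    dscale a (dadd e1 e2) ~= dadd (dscale a e1) (dscale a e2)
| de_scaleDl X Y a b (e : dhom X Y) :
    dscale (a + b) e ~= dadd (dscale a e) (dscale b e)
| de_compDl X Y Z (e1 e2 : dhom Y Z) (e : dhom X Y) :
    dcomp (dadd e1 e2) e ~= dadd (dcomp e1 e) (dcomp e2 e)
| de_compDr X Y Z (e : dhom Y Z) (e1 e2 : dhom X Y) :
    dcomp e (dadd e1 e2) ~= dadd (dcomp e e1) (dcomp e e2)
| de_compZl X Y Z a (e1 : dhom Y Z) (e2 : dhom X Y) :
    dcomp (dscale a e1) e2 ~= dscale a (dcomp e1 e2)
| de_compZr X Y Z a (e1 : dhom Y Z) (e2 : dhom X Y) :
    dcomp e1 (dscale a e2) ~= dscale a (dcomp e1 e2)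
| de_Qeq X Y (f g : chain X Y) : chain_eq f g -> Qd f ~= Qd g
| de_Qcomp X Y Z (g : chain Y Z) (f : chain X Y) :
    Qd (ccomp g f) ~= dcomp (Qd g) (Qd f)
| de_Qadd X Y (f g : chain X Y) : Qd (cadd f g) ~= dadd (Qd f) (Qd g)
| de_Qscale X Y c (f : chain X Y) : Qd (cscale c f) ~= dscale c (Qd f)
| de_invl X Y (s : chain X Y) (sq : qis s) : dcomp (dinv sq) (Qd s) ~= did X
| de_invr X Y (s : chain X Y) (sq : qis s) : dcomp (Qd s) (dinv sq) ~= did Y
where "e ~= e'" := (dequiv e e').

Definition diso X Y (e : dhom X Y) : Prop :=
  exists e' : dhom Y X, dcomp e' e ~= did X /\ dcomp e e' ~= did Y.

Fixpoint dPi (g : G) X Y (e : dhom X Y) : dhom (Pi_cplx g X) (Pi_cplx g Y) :=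
  match e with
  | Qd _ _ f => Qd (Pi_chain g f)
  | dinv _ _ _ sq => dinv (qis_Pi g sq)
  | dcomp _ _ _ e1 e2 => dcomp (dPi g e1) (dPi g e2)
  | dadd _ _ e1 e2 => dadd (dPi g e1) (dPi g e2)
  | dscale _ _ c e1 => dscale c (dPi g e1)
  end.

Fixpoint dsh X Y (e : dhom X Y) : dhom (sh_cplx X) (sh_cplx Y) :=
  match e with
  | Qd _ _ f => Qd (sh_chain f)
  | dinv _ _ _ sq => dinv (qis_sh sq)
  | dcomp _ _ _ e1 e2 => dcomp (dsh e1) (dsh e2)
  | dadd _ _ e1 e2 => dadd (dsh e1) (dsh e2)
  | dscale _ _ c e1 => dscale c (dsh e1)
  end.

Lemma dPi_equiv g X Y (e e' : dhom X Y) : e ~= e' -> dPi g e ~= dPi g e'.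
Proof.
elim=> /=; eauto using dequiv.
- move=> {e e'}X {}Y e; apply: de_trans (de_id_comp _); apply: de_comp (de_refl _).
  by apply: de_Qeq.
- move=> {e e'}X {}Y e; apply: de_trans (de_comp_id _); apply: de_comp (de_refl _) _.
  by apply: de_Qeq.
- move=> {e e'}X {}Y e; apply: de_trans (de_add0 _); apply: de_add (de_refl _).
  by apply: de_Qeq.
- move=> {e e'}X {}Y e; apply: de_trans (de_addN _) _.
  by apply: de_Qeq.
- by move=> *; apply: de_trans (de_Qcomp _ _); apply: de_Qeq.
- by move=> *; apply: de_trans (de_Qadd _ _); apply: de_Qeq.
- by move=> *; apply: de_trans (de_Qscale _ _); apply: de_Qeq.
- by move=> *; apply: de_trans (de_invl _) _; apply: de_Qeq.
- by move=> *; apply: de_trans (de_invr _) _; apply: de_Qeq.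
Qed.

Lemma dsh_equiv X Y (e e' : dhom X Y) : e ~= e' -> dsh e ~= dsh e'.
Proof.
elim=> /=; eauto using dequiv.
- move=> {e e'}X {}Y e; apply: de_trans (de_id_comp _); apply: de_comp (de_refl _).
  by apply: de_Qeq.
- move=> {e e'}X {}Y e; apply: de_trans (de_comp_id _); apply: de_comp (de_refl _) _.
  by apply: de_Qeq.
- move=> {e e'}X {}Y e; apply: de_trans (de_add0 _); apply: de_add (de_refl _).
  by apply: de_Qeq.
- move=> {e e'}X {}Y e; apply: de_trans (de_addN _) _.
  by apply: de_Qeq.
- by move=> {e e'}X {}Y f g fg; apply: de_Qeq => i; apply: fg.
- by move=> *; apply: de_trans (de_Qcomp _ _); apply: de_Qeq.
- by move=> *; apply: de_trans (de_Qadd _ _); apply: de_Qeq.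
- by move=> *; apply: de_trans (de_Qscale _ _); apply: de_Qeq.
- by move=> *; apply: de_trans (de_invl _) _; apply: de_Qeq.
- by move=> *; apply: de_trans (de_invr _) _; apply: de_Qeq.
Qed.

Definition distinguished X Y Z (u : dhom X Y) (v : dhom Y Z)
    (w : dhom Z (sh_cplx X)) : Prop :=
  exists (X' Y' : cplx A) (f : chain X' Y')
         (a : dhom X X') (b : dhom Y Y') (c : dhom Z (cone f)),
    [/\ diso a, diso b & diso c] /\
    [/\ dcomp b u ~= dcomp (Qd f) a,
        dcomp c v ~= dcomp (Qd (cone_in f)) b &
        dcomp (dsh a) w ~= dcomp (Qd (cone_out f)) c].

End Complexes.

Notation "e ~= e'" := (dequiv e e') (at level 70, no associativity).

(* k-linear functors D^b(A-gmod) -> D^b(B-gmod) *)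
Record dfunctor (k : fieldType) (G : zmodType) (A B : galg k G) := DFunctor {
  dF_ob :> cplx A -> cplx B;
  dF_map : forall X Y, dhom X Y -> dhom (dF_ob X) (dF_ob Y);
  dF_equiv : forall X Y (e e' : dhom X Y), e ~= e' -> dF_map e ~= dF_map e';
  dF_id : forall X, dF_map (did X) ~= did (dF_ob X);
  dF_comp : forall X Y Z (e1 : dhom Y Z) (e2 : dhom X Y),
    dF_map (dcomp e1 e2) ~= dcomp (dF_map e1) (dF_map e2);
  dF_add : forall X Y (e1 e2 : dhom X Y),
    dF_map (dadd e1 e2) ~= dadd (dF_map e1) (dF_map e2);
  dF_scale : forall X Y c (e : dhom X Y),
    dF_map (dscale c e) ~= dscale c (dF_map e)
}.

Section Functors.
Variables (k : fieldType) (G : zmodType).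
Implicit Types A B : galg k G.

Definition graded A B (K : dfunctor A B) : Prop :=
  exists xi : forall (g : G) (X : cplx A),
                dhom (K (Pi_cplx g X)) (Pi_cplx g (K X)),
    [/\ forall g X Y (e : dhom X Y),
          dcomp (xi g Y) (dF_map K (dPi g e))
            ~= dcomp (dPi g (dF_map K e)) (xi g X),
        forall X, dcomp (Qd (Pi0 (K X))) (xi 0 X) ~= dF_map K (Qd (Pi0 X)) &
        forall h l X,
          dcomp (Qd (PiD l h (K X)))
                (dcomp (dPi l (xi h X)) (xi l (Pi_cplx h X)))
            ~= dcomp (xi (l + h) X) (dF_map K (Qd (PiD l h X)))].

Definition triangulated A B (K : dfunctor A B) : Prop :=
  exists theta : forall X : cplx A, dhom (K (sh_cplx X)) (sh_cplx (K X)),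
    [/\ forall X, diso (theta X),
        forall X Y (e : dhom X Y),
          dcomp (theta Y) (dF_map K (dsh e))
            ~= dcomp (dsh (dF_map K e)) (theta X) &
        forall X Y Z (u : dhom X Y) (v : dhom Y Z) (w : dhom Z (sh_cplx X)),
          distinguished u v w ->
          distinguished (dF_map K u) (dF_map K v)
                        (dcomp (theta X) (dF_map K w))].

(* The composite L o K is naturally isomorphic to the identity *)
Definition left_quasi_inverse A B (L : dfunctor B A) (K : dfunctor A B) : Prop :=
  exists eta : forall X : cplx A, dhom X (L (K X)),
    (forall X, diso (eta X)) /\
    (forall X Y (e : dhom X Y),
       dcomp (eta Y) e ~= dcomp (dF_map L (dF_map K e)) (eta X)).

Record gradable_derived_equivalence A B (F : dfunctor A B) (F' : dfunctor B A) :
    Prop := GradableDerivedEquivalence {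
  gde_graded : graded F;
  gde_triangulated : triangulated F;
  gde_inv_graded : graded F';
  gde_inv_triangulated : triangulated F';
  gde_unit : left_quasi_inverse F' F;
  gde_counit : left_quasi_inverse F F'
}.

Definition one_degree A (X : cplx A) : Prop :=
  exists (n : int) (Y : cplx A), concentrated_in n Y /\ quasi_isomorphic X Y.

Definition strongly_gradable_derived_equivalent A B : Prop :=
  exists (F : dfunctor A B) (F' : dfunctor B A),
    [/\ gradable_derived_equivalence F F',
        one_degree (F (stalk (regular A))) &
        one_degree (F' (stalk (regular B)))].

End Functors.

Section GCentre.
Variables (k : fieldType) (G : zmodType) (A : galg k G).

(* A (x) k^G, as the algebra of functions G -> A with pointwise operations *)
Definition fun_alg : Type := G -> A.

HB.instance Definition _ := Choice.on fun_alg.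
HB.instance Definition _ := GRing.PzRing.copy fun_alg (G -> A).
HB.instance Definition _ := GRing.Lmodule.copy fun_alg (G -> A).

Fact fun_alg_nonzero : 1 != 0 :> fun_alg.
Proof. by apply/eqP => /(congr1 (fun x => x 0))/eqP; rewrite oner_eq0. Qed.

HB.instance Definition _ :=
  GRing.PzSemiRing_isNonZero.Build fun_alg fun_alg_nonzero.

Fact fun_alg_scalerAl (c : k) (x y : fun_alg) : c *: (x * y) = (c *: x) * y.
Proof. by apply/funext => g; apply: scalerAl. Qed.

HB.instance Definition _ :=
  GRing.Lmodule_isLalgebra.Build k fun_alg fun_alg_scalerAl.

Fact fun_alg_scalerAr (c : k) (x y : fun_alg) : c *: (x * y) = x * (c *: y).
Proof. by apply/funext => g; apply: scalerAr. Qed.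

HB.instance Definition _ :=
  GRing.Lalgebra_isAlgebra.Build k fun_alg fun_alg_scalerAr.

Definition is_gcentral (x : fun_alg) : Prop :=
  forall (g h : G) (y : A), y \in ahom_part A h -> x g * y = y * x (g + h).

Definition gcentral : {pred fun_alg} := fun x => `[< is_gcentral x >].

Fact gcentral_subalg : GRing.subalg_closed gcentral.
Proof.
split.
- by apply/asboolP => g h y _; rewrite mul1r mulr1.
- move=> c x y /asboolP xZ /asboolP yZ; apply/asboolP => g h z zA.
  change ((c *: x g + y g) * z = z * (c *: x (g + h) + y (g + h))).
  by rewrite mulrDl mulrDr -scalerAl -scalerAr (xZ _ _ _ zA) (yZ _ _ _ zA).
- move=> x y /asboolP xZ /asboolP yZ; apply/asboolP => g h z zA.
  change (x g * y g * z = z * (x (g + h) * y (g + h))).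
  by rewrite -mulrA (yZ _ _ _ zA) mulrA (xZ _ _ _ zA) mulrA.
Qed.

Record gcentre := GCentre {
  gcentre_val : fun_alg;
  gcentre_valP : gcentre_val \in gcentral
}.

HB.instance Definition _ := [isSub for gcentre_val].
HB.instance Definition _ := [Choice of gcentre by <:].
HB.instance Definition _ :=
  GRing.SubChoice_isSubAlgebra.Build k fun_alg gcentral gcentre
    (GRing.subalg_closed_semi gcentral_subalg).

Definition gcentre_deg (g : G) : set gcentre :=
  [set x : gcentre | forall l : G, gcentre_val x l \in ahom_part A g].

End GCentre.

Arguments gcentre_deg {k G} A g.

(* Elements of \hat G = Hom(G, k^x) *)
Record gchar (k : fieldType) (G : zmodType) := GChar {
  gchar_fun :> G -> k;
  gchar_neq0 : forall g, gchar_fun g != 0;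
  gcharD : forall g h, gchar_fun (g + h) = gchar_fun g * gchar_fun h
}.

Definition gcentre_char (k : fieldType) (G : zmodType) (A : galg k G)
    (chi : gchar k G) : set (gcentre A) :=
  [set x : gcentre A | forall l : G, gcentre_val x l = chi l *: gcentre_val x 0].

Arguments gcentre_char {k G} A chi.

(* Main.v *)
(* A homogeneous element [x] of degree [g] of the graded centre acts on every
   complex, a vector [m] of degree [l] being sent to [x (- l) m]. This is a
   natural transformation [eta x] from the identity to [Pi_g] on the derived
   category. Conversely, let [w] be any such natural transformation and fix a
   degree [n]. As morphisms between objects with cohomology only in degree [n]
   are detected by cohomology, and as that cohomology is generated by maps from
   the shifts of the regular module placed in degree [n], [w] coincides on those
   objects with [eta z] for exactly one [z].
   For a graded equivalence [F] with [F A] in degree [n], put [x ~ y] when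
   [xi \o F (eta x)] and [eta y] agree on the shifts of [F A]. Transporting [eta x]
   along [F] and restricting to degree [n] produces [y] from [x]; pulling back
   [eta y] and restricting to degree [0] produces [x] from [y]. Finally [x = 0]
   forces [y = 0], because [F'] maps some translate of [B] to an object in degree
   [0], on which the pull-back of [eta y] has to vanish. The coherence of [xi]
   makes [~] multiplicative and compatible with the translations [tau]; these
   detect the character grading, as [x] has character [chi] iff
   [tau l x = chi l *: x] for all [l]. *)
Require Import Defs.
From HB Require Import structures.
From Stdlib Require Import Setoid Morphisms.
From mathcomp Require Import all_boot all_order all_algebra all_field.
From mathcomp Require Import boolp classical_sets.
From mathcomp Require Import zify.
Set Implicit Arguments.
Unset Strict Implicit.
Unset Printing Implicit Defensive.
Local Open Scope classical_set_scope.
Local Open Scope ring_scope.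
Import Order.TTheory GRing.Theory.
Local Obligation Tactic := idtac.

#[local] Hint Resolve de_refl : core.

(** * Graded vector spaces *)

Section Projections.
Variables (k : fieldType) (G : zmodType) (V : vectType k) (V_ : G -> {vspace V}).
Hypothesis gV : is_grading V_.

(** A finite duplicate-free set of degrees carries the grading even if [G] is infinite. A
    homogeneous vector of another degree expands over this set, so independence forces it to
    vanish. *)
Lemma grading_support : exists s : seq G,
  [/\ uniq s, (\sum_(g <- s) V_ g)%VS = fullv &
      forall g v, g \notin s -> v \in V_ g -> v = 0].
Proof.
have [[s sE] ind] := gV.
have tE : (\sum_(g <- undup s) V_ g)%VS = fullv.
  apply/eqP; rewrite eqEsubv subvf -sE; apply/subvP => v.
  rewrite !big_seq; apply/subvP.
  elim/big_rec: _ => [|g W gs IH]; first exact: sub0v.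
  rewrite subv_add IH andbT -big_seq (big_rem g) ?mem_undup //=.
  exact: addvSl.
exists (undup s); split=> // [|g v gs vg]; first exact: undup_uniq.
have := @sumv_pi_uniq_sum _ _ _ (undup s) xpredT V_ _ (esym tE) v.
rewrite filter_predT undup_uniq memvf => /(_ isT isT) vE.
(* Moving [v] to the other side of its expansion gives a vanishing sum over [g :: undup s], to which
   independence applies. *)
pose u h := if h == g then - v else sumv_pi_for (esym tE) h v.
suff /eqP : u g = 0 by rewrite /u eqxx oppr_eq0 => /eqP.
apply: (ind (g :: undup s)); rewrite ?mem_head //= ?gs ?undup_uniq //.
  by move=> h; rewrite /u; case: eqP => [->|_]; rewrite ?rpredN // memv_sum_pi.
rewrite big_cons {1}/u eqxx -[X in - X]vE -sumrN -big_split big_seq big1 // => h ht.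
by rewrite /u; case: eqP => [hg|_]; [rewrite -hg ht in gs | rewrite /= addNr].
Qed.

Lemma grading_eq_lfun (W : vectType k) (L L' : 'Hom(V, W)) :
  (forall g v, v \in V_ g -> L v = L' v) -> L = L'.
Proof.
move=> LL'; have [s [su sE _]] := grading_support; apply/lfunP => v.
have := @sumv_pi_uniq_sum _ _ _ s xpredT V_ _ (esym sE) v.
rewrite filter_predT su memvf => /(_ isT isT) <-.
by rewrite !linear_sum; apply: eq_bigr => g _; apply/LL'/memv_sum_pi.
Qed.

(** Linear maps prescribed on the homogeneous parts are glued by composing each with its projection
    and adding over a finite support. *)
Lemma grading_lfun (W : vectType k) (phi : G -> 'Hom(V, W)) :
  exists L : 'Hom(V, W), forall g v, v \in V_ g -> L v = phi g v.
Proof.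
have [_ ind] := gV; have [s [su sE s0]] := grading_support.
exists (\sum_(g <- s) (phi g \o sumv_pi_for (esym sE) g)%VF) => g v vg.
rewrite sum_lfunE; case gs: (g \in s); last first.
  rewrite (s0 _ _ (negbT gs) vg) linear0 big1 // => h _.
  by rewrite linear0.
have := @sumv_pi_uniq_sum _ _ _ s xpredT V_ _ (esym sE) v.
rewrite filter_predT su memvf => /(_ isT isT) vE.
have H h : h \in s -> sumv_pi_for (esym sE) h v - (if h == g then v else 0) = 0.
  apply: (ind s (fun h => sumv_pi_for (esym sE) h v - (if h == g then v else 0))) => //.
    move=> l; rewrite rpredB ?memv_sum_pi //.
    by case: eqP => [->|_] //; apply: mem0v.
  rewrite sumrB vE -big_mkcond /= -big_filter.
  by rewrite filter_pred1_uniq // big_seq1 subrr.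
rewrite (bigD1_seq g) //= comp_lfunE.
have /eqP := H _ gs; rewrite eqxx subr_eq0 => /eqP ->.
rewrite big_seq_cond big1 ?addr0 // => h /andP[hs hg].
by have /eqP := H _ hs; rewrite (negPf hg) subr0 comp_lfunE => /eqP ->; rewrite linear0.
Qed.

Definition gextend (W : vectType k) (phi : G -> 'Hom(V, W)) : 'Hom(V, W) :=
  sval (cid (grading_lfun phi)).

Lemma gextendE (W : vectType k) (phi : G -> 'Hom(V, W)) g v :
  v \in V_ g -> gextend phi v = phi g v.
Proof. exact: (svalP (cid (grading_lfun phi))). Qed.

(** The projection onto the part of degree [h] along all other parts. *)
Definition gpr (h : G) : 'End(V) := gextend (fun g => if g == h then \1%VF else 0).

Lemma gpr_id h v : v \in V_ h -> gpr h v = v.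
Proof. by move=> vh; rewrite (gextendE _ vh) eqxx lfunE. Qed.

Lemma gpr_neq g h v : v \in V_ g -> g != h -> gpr h v = 0.
Proof. by move=> vg /negPf gh; rewrite (gextendE _ vg) gh lfunE. Qed.

Lemma gpr_in h v : gpr h v \in V_ h.
Proof.
have [s [su sE _]] := grading_support.
have H g u : u \in V_ g -> gpr h u \in V_ h.
  case: (eqVneq g h) => [->|gh] ug; first by rewrite (gpr_id ug).
  by rewrite (gpr_neq ug gh) mem0v.
have := @sumv_pi_uniq_sum _ _ _ s xpredT V_ _ (esym sE) v.
rewrite filter_predT su memvf => /(_ isT isT) <-; rewrite linear_sum.
by apply: memv_suml => g _; apply/H/memv_sum_pi.
Qed.

Lemma gpr_sum : exists s : seq G, [/\ uniq s,
  forall v, \sum_(g <- s) gpr g v = v & forall g v, g \notin s -> gpr g v = 0].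
Proof.
have [s [su sE s0]] := grading_support; exists s; split=> // [v|g v gs]; last first.
  exact: s0 gs (gpr_in g v).
suff E : \sum_(g <- s) gpr g = \1%VF by rewrite -sum_lfunE E lfunE.
apply: grading_eq_lfun => g u ug; rewrite lfunE sum_lfunE.
case gs: (g \in s); last by rewrite (s0 _ _ (negbT gs) ug) big1 // => h; rewrite linear0.
rewrite (bigD1_seq g) //= (gpr_id ug) big1 ?addr0 // => h.
by rewrite eq_sym => /(gpr_neq ug).
Qed.

Lemma gpr_hom h v : (forall g, g != h -> gpr g v = 0) -> v \in V_ h.
Proof.
move=> v0; have [s [su sE s0]] := gpr_sum; rewrite -(sE v) rpred_sum // => g _.
by case: (eqVneq g h) => [->|/v0->]; rewrite ?gpr_in ?mem0v.
Qed.

Lemma gpr_gpr g h v : gpr g (gpr h v) = if g == h then gpr h v else 0.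
Proof.
case: (eqVneq g h) => [->|]; first exact: gpr_id (gpr_in _ _).
by rewrite eq_sym; apply: gpr_neq (gpr_in _ _).
Qed.

Lemma gpr_big (s : seq G) (v : G -> V) h : uniq s -> (forall g, v g \in V_ g) ->
  h \in s -> gpr h (\sum_(g <- s) v g) = v h.
Proof.
move=> us vV hs; rewrite linear_sum (bigD1_seq h) //= gpr_id // big1 ?addr0 // => g.
exact: gpr_neq.
Qed.

End Projections.

Lemma gpr_nat (k : fieldType) (G : zmodType) (V W : vectType k)
    (V_ : G -> {vspace V}) (W_ : G -> {vspace W}) (gV : is_grading V_)
    (gW : is_grading W_) (f : 'Hom(V, W)) (h : G) :
  (forall g v, v \in V_ g -> f v \in W_ g) ->
  forall v, f (gpr gV h v) = gpr gW h (f v).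
Proof.
move=> fVW v; rewrite -!comp_lfunE; apply: (congr1 (fun F : 'Hom(V, W) => F v)).
apply: (grading_eq_lfun gV) => g {}v vg; rewrite !comp_lfunE.
case: (eqVneq g h) vg => [<-|gh] vg; first by rewrite !gpr_id ?fVW.
by rewrite (gpr_neq _ vg gh) linear0 (gpr_neq _ (fVW _ _ vg) gh).
Qed.

(** * Graded subquotients *)

Section GradedSubmodules.
Variables (k : fieldType) (G : zmodType) (A : galg k G).
Implicit Types M N P : gmod A.

Lemma actD M (a : A) (x y : M) : act a (x + y) = act a x + act a y.
Proof. by have := @act_linearr _ _ _ M a 1 x y; rewrite !scale1r. Qed.

Lemma actN M (a : A) (x : M) : act a (- x) = - act a x.
Proof. by apply/eqP; rewrite -addr_eq0 -actD addNr act0. Qed.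

Lemma actB M (a : A) (x y : M) : act a (x - y) = act a x - act a y.
Proof. by rewrite actD actN. Qed.

(** Stability under the degree projections replaces a decomposition of [U] into homogeneous parts;
    it passes directly to kernels and images. *)
Record is_gsub M (U : {vspace M}) : Prop := IsGSub {
  gsub_act : forall a x, x \in U -> act a x \in U;
  gsub_gpr : forall g x, x \in U -> gpr (gmod_grading M) g x \in U
}.

Lemma gsub_full M : is_gsub (fullv : {vspace M}).
Proof. by split=> *; rewrite memvf. Qed.

Lemma gsub_zero M : is_gsub (0 : {vspace M})%VS.
Proof. by split=> [a|g] x; rewrite !memv0 => /eqP ->; rewrite ?act0 ?linear0. Qed.

Lemma gmor_gpr M N (f : 'Hom(M, N)) g x : is_gmor f ->
  f (gpr (gmod_grading M) g x) = gpr (gmod_grading N) g (f x).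
Proof. by case=> _ fg; apply: gpr_nat. Qed.

Lemma gsub_ker M N (f : 'Hom(M, N)) : is_gmor f -> is_gsub (lker f).
Proof.
move=> fM; split=> [a|g] x; rewrite !memv_ker => /eqP fx.
  by rewrite (gmor_act fM) fx act0.
by rewrite gmor_gpr // fx linear0.
Qed.

Lemma gsub_img M N (f : 'Hom(M, N)) : is_gmor f -> is_gsub (limg f).
Proof.
move=> fM; split=> [a|g] _ /memv_imgP[x _ ->].
  by rewrite -(gmor_act fM) memv_img ?memvf.
by rewrite -gmor_gpr // memv_img ?memvf.
Qed.

Section Subquotient.
Variables (M : gmod A) (K L : {vspace M}).

(* The subquotient K / (K :&: L), realised on a complement of K :&: L in K. *)
Definition sqproj : 'Hom(M, subvs_of (K :\: L)%VS) :=
  (linfun (vsproj (K :\: L)%VS) \o addv_pi1 K L)%VF.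
Definition sqval : 'Hom(subvs_of (K :\: L)%VS, M) := linfun vsval.

Lemma sqvalE y : sqval y = vsval y. Proof. by rewrite lfunE. Qed.

Lemma sqprojE x : vsval (sqproj x) = addv_pi1 K L x.
Proof. by rewrite comp_lfunE lfunE /= vsprojK // memv_pi. Qed.

Lemma sqval_in y : sqval y \in K.
Proof. by rewrite sqvalE (subvP (diffvSl K L)) // subvsP. Qed.

Lemma sqvalK y : sqproj (sqval y) = y.
Proof.
apply: val_inj; rewrite /= sqprojE sqvalE daddv_pi_id ?subvsP //.
exact: capv_diff.
Qed.

Lemma sqprojB x : x \in K -> x - sqval (sqproj x) \in L.
Proof.
move=> xK; have := @addv_pi1_pi2 _ _ K L x; rewrite (subvP (addvSl K L)) // => /(_ isT) E.
by rewrite sqvalE sqprojE -{1}E addrC addKr memv_pi2.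
Qed.

Lemma sqproj0 x : x \in L -> sqproj x = 0.
Proof.
move=> xL; apply: val_inj; rewrite /= sqprojE.
have := @addv_pi1_pi2 _ _ K L x; rewrite (subvP (addvSr K L)) // => /(_ isT).
by rewrite (addv_pi2_id _ xL) => /(canRL (addrK _)); rewrite subrr.
Qed.

Lemma sqproj_eq x x' : x - x' \in L -> sqproj x = sqproj x'.
Proof. by move=> /sqproj0/eqP; rewrite linearB subr_eq0 => /eqP. Qed.

Lemma sqproj_eq0 x : x \in K -> sqproj x = 0 -> x \in L.
Proof. by move=> /sqprojB + E; rewrite E linear0 subr0. Qed.

Hypotheses (gK : is_gsub K) (gL : is_gsub L).

Definition sqact (a : A) (y : subvs_of (K :\: L)%VS) := sqproj (act a (sqval y)).
Definition sqpart (g : G) : {vspace subvs_of (K :\: L)%VS} :=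
  (sqproj @: (hom_part M g :&: K))%VS.

Lemma sqact_proj a x : x \in K -> sqact a (sqproj x) = sqproj (act a x).
Proof.
move=> xK; apply: sqproj_eq; rewrite -actB -opprB actN rpredN.
exact/(gsub_act gL)/sqprojB.
Qed.

Lemma sqpartP g y :
  reflect (exists x, [/\ x \in hom_part M g, x \in K & y = sqproj x]) (y \in sqpart g).
Proof.
apply: (iffP memv_imgP) => [[x]|[x [xM xK ->]]].
  by rewrite memv_cap => /andP[]; exists x.
by exists x; rewrite // memv_cap xM.
Qed.

(** Spanning descends through homogeneous components of representatives. For independence, a
    relation between classes lifts to a sum of homogeneous representatives lying in [L], and [L],
    being graded, contains each of them. *)
Lemma sq_grading : is_grading sqpart.
Proof.
split.
  have [s [_ sE _]] := gpr_sum (gmod_grading M); exists s.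
  apply/eqP; rewrite eqEsubv subvf; apply/subvP => y _.
  rewrite -(sqvalK y) -{1}(sE (sqval y)) linear_sum.
  apply: (big_ind2 (fun (x : subvs_of (K :\: L)%VS) (U : {vspace _}) => x \in U))
    => [|x U z W xU zW|g _].
  - exact: mem0v.
  - exact: memv_add.
  - apply/sqpartP; exists (gpr (gmod_grading M) g (sqval y)); split=> //.
      exact: gpr_in.
    exact/(gsub_gpr gK)/sqval_in.
move=> s v us vV v0 g gs.
have /choice[m mP] : forall h, exists x, [/\ x \in hom_part M h, x \in K & v h = sqproj x].
  by move=> h; apply/sqpartP/vV.
have mL : \sum_(h <- s) m h \in L.
  apply: sqproj_eq0; first by apply: rpred_sum => h _; have [] := mP h.
  by rewrite linear_sum -[RHS]v0; apply: eq_bigr => h _; have [] := mP h.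
have [mg mK ->] := mP g; apply: sqproj0.
rewrite -(@gpr_big _ _ _ _ (gmod_grading M) s m g us) //; first exact: gsub_gpr.
by move=> h; have [] := mP h.
Qed.

Program Definition gsq : gmod A :=
  @GMod k G A (subvs_of (K :\: L)%VS) sqact sqpart _ _ _ _ sq_grading _.
Next Obligation. by move=> y c a b; rewrite /sqact act_linearl linearP. Qed.
Next Obligation. by move=> a c x y; rewrite /sqact linearP act_linearr linearP. Qed.
Next Obligation. by move=> y; rewrite /sqact act_one sqvalK. Qed.
Next Obligation.
move=> a b y; rewrite -[in LHS](sqvalK y) -[in RHS](sqvalK y).
have yK := sqval_in y; rewrite !sqact_proj ?act_mul //; exact: gsub_act.
Qed.
Next Obligation.
move=> h g a _ ah /sqpartP[x [xM xK ->]]; rewrite sqact_proj //; apply/sqpartP.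
by exists (act a x); split; [apply: act_grade|apply: gsub_act|].
Qed.

End Subquotient.

Lemma sqproj0K M (K : {vspace M}) x : x \in K -> sqval K 0%VS (sqproj K 0%VS x) = x.
Proof. by move=> /(sqprojB 0%VS); rewrite memv0 subr_eq0 => /eqP. Qed.

Section SubquotientMaps.
Variables (M N : gmod A) (K L : {vspace M}) (K' L' : {vspace N}).
Variables (gK : is_gsub K) (gL : is_gsub L) (gK' : is_gsub K') (gL' : is_gsub L').
Variable f : 'Hom(M, N).
Hypotheses (fM : is_gmor f).
Hypotheses (fK : forall x, x \in K -> f x \in K').

Definition sqmap : 'Hom(gsq gK gL, gsq gK' gL') :=
  (sqproj K' L' \o (f \o sqval K L))%VF.

Hypothesis fL : forall x, x \in K -> x \in L -> f x \in L'.

Lemma sqmapE x : x \in K -> sqmap (sqproj K L x) = sqproj K' L' (f x).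
Proof.
move=> xK; rewrite comp_lfunE [(f \o _)%VF _]comp_lfunE; apply: sqproj_eq.
rewrite -linearB -opprB linearN rpredN; apply: fL; last exact: sqprojB.
by rewrite rpredB // sqval_in.
Qed.

Lemma gmor_sqmap : is_gmor sqmap.
Proof.
split=> [a y|g _ /sqpartP[x [xM xK ->]]].
  have yK := sqval_in y; rewrite -[y]sqvalK.
  rewrite [act a _](sqact_proj gL) // !sqmapE //; last exact: gsub_act.
  by rewrite (gmor_act fM) [RHS](sqact_proj gL') // fK.
rewrite sqmapE //; apply/sqpartP; exists (f x); split=> //; last exact: fK.
exact: (gmor_grade fM).
Qed.

End SubquotientMaps.

End GradedSubmodules.

(** * Calculus in the derived category *)

#[local] Instance dequiv_equivalence (k : fieldType) (G : zmodType)
  (A : galg k G) (X Y : cplx A) : Equivalence (@dequiv k G A X Y).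
Proof.
split; first exact: de_refl; first exact: de_sym.
by move=> e e' e''; apply: de_trans.
Qed.

#[local] Instance dcomp_proper (k : fieldType) (G : zmodType) (A : galg k G)
  (X Y Z : cplx A) :
  Proper (@dequiv k G A Y Z ==> @dequiv k G A X Y ==> @dequiv k G A X Z)
    (@dcomp k G A X Y Z).
Proof. by move=> e1 e1' ? e2 e2' ?; apply: de_comp. Qed.

#[local] Instance dadd_proper (k : fieldType) (G : zmodType) (A : galg k G)
  (X Y : cplx A) :
  Proper (@dequiv k G A X Y ==> @dequiv k G A X Y ==> @dequiv k G A X Y)
    (@dadd k G A X Y).
Proof. by move=> e1 e1' ? e2 e2' ?; apply: de_add. Qed.

#[local] Instance dscale_proper (k : fieldType) (G : zmodType) (A : galg k G)
  (X Y : cplx A) (c : k) :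
  Proper (@dequiv k G A X Y ==> @dequiv k G A X Y) (@dscale k G A X Y c).
Proof. by move=> e1 e1' ?; apply: de_scale. Qed.

#[local] Instance dPi_proper (k : fieldType) (G : zmodType) (A : galg k G)
  (g : G) (X Y : cplx A) :
  Proper (@dequiv k G A X Y ==> @dequiv k G A (Pi_cplx g X) (Pi_cplx g Y))
    (@dPi k G A g X Y).
Proof. by move=> e e'; apply: dPi_equiv. Qed.

#[local] Instance dF_map_proper (k : fieldType) (G : zmodType) (A B : galg k G)
  (F : dfunctor A B) (X Y : cplx A) :
  Proper (@dequiv k G A X Y ==> @dequiv k G B (F X) (F Y)) (@dF_map k G A B F X Y).
Proof. by move=> e e'; apply: dF_equiv. Qed.

Section DerivedCategory.
Variables (k : fieldType) (G : zmodType) (A : galg k G).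
Implicit Types X Y Z W : cplx A.

Lemma dcompKl X Y Z (a : dhom Y Z) (b : dhom Z Y) (e : dhom X Y) :
  dcomp b a ~= did Y -> dcomp b (dcomp a e) ~= e.
Proof. by move=> ba; rewrite de_compA ba de_id_comp. Qed.

Lemma dcompKr X Y Z (a : dhom X Y) (b : dhom Y X) (e : dhom Y Z) :
  dcomp a b ~= did Y -> dcomp (dcomp e a) b ~= e.
Proof. by move=> ab; rewrite -de_compA ab de_comp_id. Qed.

Lemma dmonoP X Y Z (a : dhom Y Z) (b : dhom Z Y) (e e' : dhom X Y) :
  dcomp b a ~= did Y -> dcomp a e ~= dcomp a e' -> e ~= e'.
Proof. by move=> ba E; rewrite -(dcompKl e ba) E dcompKl. Qed.

Lemma depiP X Y Z (a : dhom X Y) (b : dhom Y X) (e e' : dhom Y Z) :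
  dcomp a b ~= did Y -> dcomp e a ~= dcomp e' a -> e ~= e'.
Proof. by move=> ab E; rewrite -(dcompKr e ab) E dcompKr. Qed.

Lemma diso_id X : diso (did X).
Proof. by exists (did X); split; apply: de_id_comp. Qed.

Lemma diso_comp X Y Z (b : dhom Y Z) (a : dhom X Y) :
  diso b -> diso a -> diso (dcomp b a).
Proof.
move=> [b' [b'b bb']] [a' [a'a aa']]; exists (dcomp a' b'); split.
  by rewrite -de_compA dcompKl.
by rewrite -de_compA dcompKl.
Qed.

Lemma diso_equiv X Y (a a' : dhom X Y) : a ~= a' -> diso a -> diso a'.
Proof. by move=> E [b [ba ab]]; exists b; rewrite -E. Qed.

Lemma diso_qis X Y (s : chain X Y) : qis s -> diso (Qd s).
Proof. by move=> sq; exists (dinv sq); split; [apply: de_invl | apply: de_invr]. Qed.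

Definition disomorphic X Y := exists a : dhom X Y, diso a.

Lemma disomorphic_refl X : disomorphic X X.
Proof. by exists (did X); apply: diso_id. Qed.

Lemma disomorphic_sym X Y : disomorphic X Y -> disomorphic Y X.
Proof. by move=> [a [b [ba ab]]]; exists b, a. Qed.

Lemma disomorphic_trans X Y Z :
  disomorphic X Y -> disomorphic Y Z -> disomorphic X Z.
Proof. by move=> [a ai] [b bi]; exists (dcomp b a); apply: diso_comp. Qed.

Lemma qis_disomorphic X Y (s : chain X Y) : qis s -> disomorphic X Y.
Proof. by move=> sq; exists (Qd s); apply: diso_qis. Qed.

Lemma cidE X i x : Defs.cid X i x = x.
Proof. exact: id_lfunE. Qed.

Lemma ccompE X Y Z (g : chain Y Z) (f : chain X Y) i x : ccomp g f i x = g i (f i x).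
Proof. exact: comp_lfunE. Qed.

Lemma czeroE X Y i x : czero X Y i x = 0.
Proof. exact: zero_lfunE. Qed.

Lemma caddE X Y (f g : chain X Y) i x : cadd f g i x = f i x + g i x.
Proof. exact: add_lfunE. Qed.

Lemma cscaleE X Y c (f : chain X Y) i x : cscale c f i x = c *: f i x.
Proof. exact: scale_lfunE. Qed.

Lemma Qd_eq X Y Z (f : chain Y Z) (g : chain X Y) (h : chain X Z) :
  (forall i x, f i (g i x) = h i x) -> dcomp (Qd f) (Qd g) ~= Qd h.
Proof.
move=> E; rewrite -de_Qcomp; apply: de_Qeq => i; apply/lfunP => x.
by rewrite comp_lfunE E.
Qed.

Lemma Qd_square X Y Z W (f : chain Y Z) (g : chain X Y) (f' : chain W Z)
    (g' : chain X W) :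
  (forall i x, f i (g i x) = f' i (g' i x)) ->
  dcomp (Qd f) (Qd g) ~= dcomp (Qd f') (Qd g').
Proof.
move=> E; rewrite -(de_Qcomp f' g'); apply: Qd_eq => i x.
by rewrite comp_lfunE E.
Qed.

Lemma chain_eqP X Y (f g : chain X Y) :
  (forall i x, f i x = g i x) -> Qd f ~= Qd g.
Proof. by move=> E; apply: de_Qeq => i; apply/lfunP/E. Qed.

Lemma qis_bij X Y (s : chain X Y) :
  (forall i, injective (s i)) -> (forall i y, exists x, y = s i x) -> qis s.
Proof.
move=> inj sur i; split=> [x dx [y sx]|y dy].
  have [x' yE] := sur i y; exists x'; apply: (inj (i + 1)).
  by rewrite sx yE chain_diff.
have [x yE] := sur (i + 1) y; exists x.
  apply: (inj (i + 1 + 1)); rewrite linear0.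
  by transitivity (diff Y (i + 1) (s (i + 1) x)); [exact: chain_diff|rewrite -yE].
by exists 0; rewrite linear0 addr0.
Qed.

(** As [f] is injective and commutes with the projections, the preimage of a homogeneous vector has
    no component in another degree. *)
Lemma gmor_inv (M N : gmod A) (f : 'Hom(M, N)) : is_gmor f ->
  cancel f (f^-1)%VF -> cancel (f^-1)%VF f -> is_gmor (f^-1)%VF.
Proof.
move=> fM fK fVK; split=> [a m|g m mN].
  by apply: (can_inj fK); rewrite (gmor_act fM) !fVK.
apply: (gpr_hom (gV := gmod_grading M)) => h hg; apply: (can_inj fK).
rewrite gmor_gpr // fVK linear0; apply: gpr_neq mN _.
by rewrite eq_sym.
Qed.

Section InverseChain.
Variables (X Y : cplx A) (s : chain X Y).
Hypotheses (inj : forall i, injective (s i)).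
Hypotheses (sur : forall i y, exists x, y = s i x).

Lemma chainK i : cancel (s i) (s i)^-1%VF.
Proof. exact/lker0_lfunK/lker0P. Qed.

Lemma chainVK i : cancel (s i)^-1%VF (s i).
Proof. by move=> y; have [x ->] := sur y; rewrite chainK. Qed.

Program Definition cinv : chain Y X := @Chain _ _ _ Y X (fun i => (s i)^-1%VF) _ _.
Next Obligation. by move=> i; apply: gmor_inv (chain_gmor s i) (@chainK i) (@chainVK i). Qed.
Next Obligation.
move=> i y; apply: (@inj (i + 1)); rewrite chainVK.
by rewrite -[X in diff Y i X](chainVK y) (chain_diff s).
Qed.

End InverseChain.

End DerivedCategory.

(** What an induction over formal morphisms uses. Unlike [dfunctor], it does not ask for
    compatibility with [~=], so that maps defined by recursion on formal morphisms qualify with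
    little work. *)
Record premap (k : fieldType) (G : zmodType) (A B : galg k G) := PreMap {
  pm_ob :> cplx A -> cplx B;
  pm_map : forall X Y, dhom X Y -> dhom (pm_ob X) (pm_ob Y);
  pm_comp : forall X Y Z (e1 : dhom Y Z) (e2 : dhom X Y),
    pm_map (dcomp e1 e2) ~= dcomp (pm_map e1) (pm_map e2);
  pm_add : forall X Y (e1 e2 : dhom X Y),
    pm_map (dadd e1 e2) ~= dadd (pm_map e1) (pm_map e2);
  pm_scale : forall X Y c (e : dhom X Y),
    pm_map (dscale c e) ~= dscale c (pm_map e);
  pm_invl : forall X Y (s : chain X Y) (sq : qis s),
    dcomp (pm_map (dinv sq)) (pm_map (Qd s)) ~= did (pm_ob X);
  pm_invr : forall X Y (s : chain X Y) (sq : qis s),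
    dcomp (pm_map (Qd s)) (pm_map (dinv sq)) ~= did (pm_ob Y)
}.

(** Composites, sums and multiples are immediate by induction. For a formal inverse, precompose with
    the image of the quasi-isomorphism, which can be cancelled, and use naturality there. *)
Lemma pm_natural (k : fieldType) (G : zmodType) (A B : galg k G)
    (K L : premap A B) (c : forall X, dhom (K X) (L X)) :
  (forall X Y (f : chain X Y),
     dcomp (c Y) (pm_map K (Qd f)) ~= dcomp (pm_map L (Qd f)) (c X)) ->
  forall X Y (e : dhom X Y),
    dcomp (c Y) (pm_map K e) ~= dcomp (pm_map L e) (c X).
Proof.
move=> cQ X Y; elim=> {X Y} [X Y f|X Y s sq|X Y Z e1 IH1 e2 IH2|X Y e1 IH1 e2 IH2|X Y a e IH].
- exact: cQ.
- apply: (depiP (pm_invr K sq)); rewrite -!de_compA cQ pm_invl de_comp_id.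
  by rewrite dcompKl // pm_invl.
- by rewrite !pm_comp de_compA IH1 -de_compA IH2 de_compA.
- by rewrite !pm_add de_compDr de_compDl IH1 IH2.
- by rewrite !pm_scale de_compZr de_compZl IH.
Qed.

Section PreMaps.
Variables (k : fieldType) (G : zmodType).

Definition pm_id (A : galg k G) : premap A A.
Proof.
refine (@PreMap k G A A (fun X => X) (fun X Y e => e) _ _ _ _ _) => //.
- by move=> *; apply: de_invl.
- by move=> *; apply: de_invr.
Defined.

Definition pm_Pi (A : galg k G) (g : G) : premap A A.
Proof.
refine (@PreMap k G A A (Pi_cplx g) (dPi g) _ _ _ _ _) => //=.
- by move=> *; rewrite de_invl; apply: chain_eqP => i x.
- by move=> *; rewrite de_invr; apply: chain_eqP => i x.
Defined.

Definition pm_comp_map (A B C : galg k G) (L : dfunctor B C) (K : premap A B) :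
  premap A C.
Proof.
refine (@PreMap k G A C (fun X => L (K X)) (fun X Y e => dF_map L (pm_map K e)) _ _ _ _ _).
- by move=> *; rewrite pm_comp dF_comp.
- by move=> *; rewrite pm_add dF_add.
- by move=> *; rewrite pm_scale dF_scale.
- by move=> *; rewrite -dF_comp pm_invl dF_id.
- by move=> *; rewrite -dF_comp pm_invr dF_id.
Defined.

Program Definition dPi_functor (A : galg k G) (g : G) : dfunctor A A :=
  @DFunctor k G A A (Pi_cplx g) (dPi g) _ _ _ _ _.
Next Obligation. by move=> *; apply: dPi_equiv. Qed.
Next Obligation. by move=> *; apply: chain_eqP. Qed.
Next Obligation. by []. Qed.
Next Obligation. by []. Qed.
Next Obligation. by []. Qed.

Lemma dF_diso (A B : galg k G) (F : dfunctor A B) X Y (a : dhom X Y) :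
  diso a -> diso (dF_map F a).
Proof.
by move=> [b [ba ab]]; exists (dF_map F b); rewrite -!dF_comp ba ab !dF_id.
Qed.

Lemma dF_disomorphic (A B : galg k G) (F : dfunctor A B) X Y :
  disomorphic X Y -> disomorphic (F X) (F Y).
Proof. by move=> [a ai]; exists (dF_map F a); apply: dF_diso. Qed.

End PreMaps.

(** * Subquotients of complexes *)

Section SubquotientComplexes.
Variables (k : fieldType) (G : zmodType) (A : galg k G).
Implicit Types X Y Z W : cplx A.

(** In each degree the quotient is by [K i :&: L i]; taking [fullv] for [L i] therefore kills the
    term. *)
Record is_subquo X (K L : forall i, {vspace X i}) : Prop := IsSubquo {
  subquo_K : forall i, is_gsub (K i);
  subquo_L : forall i, is_gsub (L i);
  subquo_dK : forall i x, x \in K i -> diff X i x \in K (i + 1);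
  subquo_dL : forall i x, x \in K i -> x \in L i -> diff X i x \in L (i + 1)
}.

Program Definition sqcplx X K L (h : @is_subquo X K L) : cplx A :=
  @Cplx _ _ _ (fun i => gsq (subquo_K h i) (subquo_L h i))
    (fun i => sqmap (subquo_K h i) (subquo_L h i) (subquo_K h (i + 1))
                    (subquo_L h (i + 1)) (diff X i)) _ _ _.
Next Obligation.
move=> X K L h i; apply: gmor_sqmap; first exact: diff_gmor.
  exact: (subquo_dK h).
exact: (subquo_dL h).
Qed.
Next Obligation.
move=> X K L h i y; have yK := sqval_in y.
have E j x (xK : x \in K j) := sqmapE (subquo_K h j) (subquo_L h j)
  (subquo_K h (j + 1)) (subquo_L h (j + 1)) (@subquo_dL _ _ _ h j) xK.
rewrite -(sqvalK y) E // E; last exact: (subquo_dK h).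
by rewrite diff_diff linear0.
Qed.
Next Obligation.
move=> X K L h; have [a [b X0]] := cplx_bounded X; exists a, b => i iab y.
by apply: val_inj; apply: X0.
Qed.

Section SubquotientChains.
Variables (X Y : cplx A).
Variables (K L : forall i, {vspace X i}) (K' L' : forall i, {vspace Y i}).
Variables (h : is_subquo K L) (h' : is_subquo K' L') (f : chain X Y).
Hypotheses (fK : forall i x, x \in K i -> f i x \in K' i).
Hypotheses (fL : forall i x, x \in K i -> x \in L i -> f i x \in L' i).

Lemma sqdiffE i x : x \in K i ->
  diff (sqcplx h) i (sqproj (K i) (L i) x) = sqproj (K (i + 1)) (L (i + 1)) (diff X i x).
Proof. by move=> xK; apply: sqmapE => // z; apply: (subquo_dL h). Qed.

Program Definition sqchain : chain (sqcplx h) (sqcplx h') :=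
  @Chain _ _ _ (sqcplx h) (sqcplx h')
    (fun i => sqmap (subquo_K h i) (subquo_L h i) (subquo_K h' i) (subquo_L h' i) (f i)) _ _.
Next Obligation.
move=> i; apply: gmor_sqmap; first exact: chain_gmor.
  exact: (@fK i).
exact: (@fL i).
Qed.
Next Obligation.
move=> i y; have yK := sqval_in y.
have E j x (xK : x \in K j) := sqmapE (subquo_K h j) (subquo_L h j)
  (subquo_K h' j) (subquo_L h' j) (@fL j) xK.
have D j x (xK : x \in K' j) := sqmapE (subquo_K h' j) (subquo_L h' j)
  (subquo_K h' (j + 1)) (subquo_L h' (j + 1)) (@subquo_dL _ _ _ h' j) xK.
rewrite -(sqvalK y) sqdiffE // E ?(subquo_dK h) // E // D; last exact: fK.
by rewrite chain_diff.
Qed.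

Lemma sqchainE i x : x \in K i -> sqchain i (sqproj (K i) (L i) x) = sqproj (K' i) (L' i) (f i x).
Proof. by move=> xK; apply: sqmapE => // z; apply: fL. Qed.

Lemma sqcplxP i (y : sqcplx h i) : exists2 x, x \in K i & y = sqproj (K i) (L i) x.
Proof. by exists (sqval (K i) (L i) y); rewrite ?sqval_in ?sqvalK. Qed.

End SubquotientChains.

Section SubComplexes.
Variables (X : cplx A) (K : forall i, {vspace X i}).
Variables (h : is_subquo K (fun i => 0%VS)).

Program Definition sub_incl : chain (sqcplx h) X :=
  @Chain _ _ _ (sqcplx h) X (fun i => sqval (K i) 0%VS) _ _.
Next Obligation.
move=> i; split=> [a y|g _ /sqpartP[x [xM xK ->]]]; last by rewrite sqproj0K.
by rewrite sqproj0K // (gsub_act (subquo_K h i)) ?sqval_in.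
Qed.
Next Obligation.
move=> i y; rewrite -{1}(sqvalK y) sqdiffE ?sqval_in //.
by rewrite sqproj0K // (subquo_dK h) ?sqval_in.
Qed.

Lemma sub_inclE i x : x \in K i -> sub_incl i (sqproj (K i) 0%VS x) = x.
Proof. exact: sqproj0K. Qed.

Lemma sub_incl_inj i : injective (sub_incl i).
Proof. exact: can_inj (@sqvalK _ _ _ _ _ _). Qed.

End SubComplexes.

End SubquotientComplexes.

(** * Truncation and cohomology *)

Section Boundaries.
Variables (k : fieldType) (G : zmodType) (A : galg k G).
Implicit Types X Y : cplx A.

Definition bnd_from X i j (e : j + 1 = i) : {vspace X i} :=
  ecast l {vspace X l} e (limg (diff X j)).

(* The boundaries in degree i, transported along i - 1 + 1 = i. *)
Definition bnd X i : {vspace X i} := bnd_from X (subrK 1 i).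

Lemma bndS X i : bnd X (i + 1) = limg (diff X i).
Proof.
(* Generalising over the source degree and the equation lets the transport be removed by uniqueness
   of equality proofs. *)
suff E j (e : j + 1 = i + 1) : bnd_from X e = limg (diff X i) by apply: E.
have ji : j = i by apply: addIr e.
by move: e; rewrite ji => e; rewrite /bnd_from eq_axiomK.
Qed.

(** Replaces a degree by a successor, where the incoming differential can be named. *)
Lemma int_predP (i : int) : exists j, i = j + 1.
Proof. by exists (i - 1); rewrite subrK. Qed.

Lemma gsub_bnd X i : is_gsub (bnd X i).
Proof. by have [j ->] := int_predP i; rewrite bndS; apply/gsub_img/diff_gmor. Qed.

Lemma chain_bnd X Y (f : chain X Y) i x : x \in bnd X i -> f i x \in bnd Y i.
Proof.
have [j ji] := int_predP i; move: x; rewrite ji => x; rewrite !bndS.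
by move=> /memv_imgP[z _ ->]; rewrite chain_diff memv_img ?memvf.
Qed.

End Boundaries.

Section Truncation.
Variables (k : fieldType) (G : zmodType) (A : galg k G) (n : int).
Implicit Types X Y Z : cplx A.

(** Modulo zero this is the truncation to degrees at most [n]. Modulo [trL], which kills the other
    degrees and divides out the boundaries in degree [n], it is the cohomology in degree [n]. *)
Definition trK X i : {vspace X i} :=
  if (i < n)%R then fullv else if i == n then lker (diff X i) else 0%VS.
Definition trL X i : {vspace X i} := if i == n then bnd X i else fullv.

Lemma trK_lt X i : i < n -> trK X i = fullv. Proof. by rewrite /trK => ->. Qed.
Lemma trK_gt X i : n < i -> trK X i = 0%VS.
Proof. by move=> ni; rewrite /trK ltNge ltW //= gt_eqF. Qed.
Lemma trK_n X i : i = n -> trK X i = lker (diff X i).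
Proof. by move=> ->; rewrite /trK ltxx eqxx. Qed.

Lemma trK_gt0 X i x : n < i -> x \in trK X i -> x = 0.
Proof. by move=> /trK_gt ->; rewrite memv0 => /eqP. Qed.

Lemma trK_ker X i x : i = n -> x \in trK X i -> diff X i x = 0.
Proof. by move=> /trK_n ->; rewrite memv_ker => /eqP. Qed.

Lemma trL_n X i : i = n -> trL X i = bnd X i.
Proof. by move=> ->; rewrite /trL eqxx. Qed.

Lemma gsub_trK X i : is_gsub (trK X i).
Proof.
rewrite /trK; case: ifP => _; first exact: gsub_full.
case: ifP => _; last exact: gsub_zero.
exact/gsub_ker/diff_gmor.
Qed.

Lemma gsub_trL X i : is_gsub (trL X i).
Proof. by rewrite /trL; case: ifP => _; [apply: gsub_bnd | apply: gsub_full]. Qed.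

Lemma diff_trK X i x : x \in trK X i -> diff X i x \in trK X (i + 1).
Proof.
case: (ltgtP i n) => [lt_in|gt_in|eq_in] xK.
- case: (ltgtP (i + 1) n) => [lt|gt|eq]; first by rewrite trK_lt ?memvf.
  + by move: lt_in gt; lia.
  + by rewrite trK_n // memv_ker diff_diff.
- by move: xK; rewrite trK_gt // memv0 => /eqP ->; rewrite linear0 mem0v.
- by move: xK; rewrite trK_n // memv_ker => /eqP ->; rewrite mem0v.
Qed.

Lemma subquo_trunc X : is_subquo (trK X) (fun i => 0%VS : {vspace X i}).
Proof.
split=> [i|i|i x|i x _]; [exact: gsub_trK|exact: gsub_zero|exact: diff_trK|].
by rewrite !memv0 => /eqP ->; rewrite linear0.
Qed.

Lemma subquo_coh X : is_subquo (trK X) (trL X).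
Proof.
split=> [i|i|i x|i x _ _]; [exact: gsub_trK|exact: gsub_trL|exact: diff_trK|].
rewrite /trL; case: eqP => _; last exact: memvf.
by rewrite bndS memv_img ?memvf.
Qed.

Lemma chain_trK X Y (f : chain X Y) i x : x \in trK X i -> f i x \in trK Y i.
Proof.
rewrite /trK; case: ifP => _; first by rewrite !memvf.
case: ifP => _; last by rewrite !memv0 => /eqP ->; rewrite linear0.
by rewrite !memv_ker -chain_diff => /eqP ->; rewrite linear0.
Qed.

Lemma chain_trL X Y (f : chain X Y) i x : x \in trL X i -> f i x \in trL Y i.
Proof.
rewrite /trL; case: ifP => _; last by rewrite !memvf.
exact: chain_bnd.
Qed.

Definition trunc X : cplx A := sqcplx (subquo_trunc X).
Definition coh X : cplx A := sqcplx (subquo_coh X).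

Lemma chain_0 X Y (f : chain X Y) i x :
  x \in trK X i -> x \in (0 : {vspace X i})%VS -> f i x \in (0 : {vspace Y i})%VS.
Proof. by rewrite !memv0 => _ /eqP ->; rewrite linear0. Qed.

Definition trunc_chain X Y (f : chain X Y) : chain (trunc X) (trunc Y) :=
  sqchain (subquo_trunc X) (subquo_trunc Y) (@chain_trK _ _ f) (@chain_0 _ _ f).

Definition coh_chain X Y (f : chain X Y) : chain (coh X) (coh Y) :=
  sqchain (subquo_coh X) (subquo_coh Y) (@chain_trK _ _ f)
    (fun i x _ => @chain_trL _ _ f i x).

Definition trunc_incl X : chain (trunc X) X := sub_incl (subquo_trunc X).

Fact cid_trK X i x : x \in trK X i -> Defs.cid X i x \in trK X i.
Proof. by rewrite lfunE. Qed.

Fact cid_0 X i x :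
  x \in trK X i -> x \in (0 : {vspace X i})%VS -> Defs.cid X i x \in trL X i.
Proof. by rewrite memv0 lfunE => _ /eqP ->; rewrite mem0v. Qed.

Definition trunc_coh X : chain (trunc X) (coh X) :=
  sqchain (subquo_trunc X) (subquo_coh X) (@cid_trK X) (@cid_0 X).

Lemma trunc_chainE X Y (f : chain X Y) i x : x \in trK X i ->
  trunc_chain f i (sqproj (trK X i) 0%VS x) = sqproj (trK Y i) 0%VS (f i x).
Proof. by move=> xK; rewrite [LHS]sqchainE. Qed.

Lemma coh_chainE X Y (f : chain X Y) i x : x \in trK X i ->
  coh_chain f i (sqproj (trK X i) (trL X i) x) = sqproj (trK Y i) (trL Y i) (f i x).
Proof. by move=> xK; rewrite [LHS]sqchainE. Qed.

Lemma trunc_cohE X i x : x \in trK X i ->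
  trunc_coh X i (sqproj (trK X i) 0%VS x) = sqproj (trK X i) (trL X i) x.
Proof. by move=> xK; rewrite [LHS]sqchainE //; congr (sqproj _ _ _); rewrite lfunE. Qed.

Lemma trunc_inclE X i x : x \in trK X i ->
  trunc_incl X i (sqproj (trK X i) 0%VS x) = x.
Proof. exact: sub_inclE. Qed.

Lemma trunc_incl_natural X Y (f : chain X Y) i y :
  trunc_incl Y i (trunc_chain f i y) = f i (trunc_incl X i y).
Proof.
have [x xK ->] := sqcplxP y.
by rewrite trunc_chainE // !trunc_inclE // chain_trK.
Qed.

Lemma trunc_coh_natural X Y (f : chain X Y) i y :
  trunc_coh Y i (trunc_chain f i y) = coh_chain f i (trunc_coh X i y).
Proof.
have [x xK ->] := sqcplxP y.
by rewrite trunc_chainE // !trunc_cohE ?chain_trK // coh_chainE.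
Qed.

(** Up to degree [n] the truncation has the cocycles and boundaries of the complex, and above [n] it
    vanishes. *)
Lemma trunc_qis X Y (s : chain X Y) : qis s -> qis (trunc_chain s).
Proof.
move=> sq i; have [inj sur] := sq i; have [lt|le] := ltP n (i + 1).
  have y0 Z (y : trunc Z (i + 1)) : y = 0.
    by have [x xK ->] := sqcplxP y; rewrite (trK_gt0 lt xK) linear0.
  split=> [y _ _|y _]; exists 0; rewrite ?linear0 ?(y0 _ y) //.
  by exists 0; rewrite !linear0 addr0.
(* From [i + 1 <= n] the source of the incoming differential lies strictly below [n], where nothing
   has been cut off. *)
have iK Z (x : Z i) : x \in trK Z i by rewrite trK_lt ?memvf //; lia.
have cK Z (x : Z (i + 1)) : diff Z (i + 1) x = 0 -> x \in trK Z (i + 1).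
  move=> dx; case: (ltgtP (i + 1) n) (le) => // [lt|eq] _; first by rewrite trK_lt ?memvf.
  by rewrite trK_n // memv_ker dx.
have incD Z j (z : trunc Z j) :
    diff Z j (trunc_incl Z j z) = trunc_incl Z (j + 1) (diff (trunc Z) j z).
  by rewrite chain_diff.
split=> y dy.
  move=> [y' E]; have [] := inj (trunc_incl X _ y).
  - by rewrite incD dy linear0.
  - by exists (trunc_incl Y i y'); rewrite incD -E trunc_incl_natural.
  move=> x xE; exists (sqproj (trK X i) 0%VS x).
  by apply: (sub_incl_inj (h := subquo_trunc X)); rewrite sqdiffE // sub_inclE ?diff_trK.
have [|x dx [y' E]] := sur (trunc_incl Y _ y); first by rewrite incD dy linear0.
have xK := cK _ _ dx.
exists (sqproj (trK X (i + 1)) 0%VS x); first by rewrite sqdiffE // dx linear0.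
exists (sqproj (trK Y i) 0%VS y').
apply: (sub_incl_inj (h := subquo_trunc Y)).
rewrite [LHS]E linearD sqdiffE // trunc_chainE //; congr (_ + _); apply/esym.
  exact/trunc_inclE/chain_trK.
exact/trunc_inclE/diff_trK.
Qed.

Lemma coh_eq0 X i (y : coh X i) : i != n -> y = 0.
Proof.
have [x xK ->] := sqcplxP y; case: ltgtP xK => // [lt|gt] xK _.
  by apply: sqproj0; rewrite /trL lt_eqF ?memvf.
by rewrite (trK_gt0 gt xK) linear0.
Qed.

Lemma coh_chain_inj X Y (s : chain X Y) : qis s -> forall i, injective (coh_chain s i).
Proof.
move=> sq i y1 y2 /eqP; rewrite -subr_eq0 -linearB => /eqP.
suff K0 y : coh_chain s i y = 0 -> y = 0.
  by move=> /K0/eqP; rewrite subr_eq0 => /eqP.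
case: (eqVneq i n) => [i_n|/(coh_eq0 y)-> //].
have [x xK ->] := sqcplxP y; rewrite coh_chainE // => E.
apply: sqproj0; have := sqproj_eq0 (chain_trK s xK) E.
rewrite trL_n // trL_n //; move: (trK_ker i_n xK) => {xK y E}.
have [j ji] := int_predP i; move: x; rewrite ji => x dx; rewrite !bndS.
move=> /memv_imgP[z _ sx]; have [inj _] := sq j.
by have [|x' ->] := inj x dx; [exists z | rewrite memv_img ?memvf].
Qed.

Lemma coh_chain_sur X Y (s : chain X Y) : qis s ->
  forall i y, exists x, y = coh_chain s i x.
Proof.
move=> sq i y; case: (eqVneq i n) => [i_n|/(coh_eq0 y)->]; last by exists 0; rewrite linear0.
have [z zK ->] := sqcplxP y.
suff [x xK E] : exists2 x, x \in trK X i & z - s i x \in trL Y i.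
  exists (sqproj (trK X i) (trL X i) x).
  by rewrite coh_chainE //; apply: sqproj_eq.
rewrite trK_n // trL_n //; move: (trK_ker i_n zK) => {zK y}.
have [j ji] := int_predP i; move: z; rewrite ji => z dz; rewrite bndS.
have [_ sur] := sq j; have [x dx [y' ->]] := sur z dz.
exists x; first by rewrite memv_ker dx.
by rewrite [s _ _ + _]addrC addrK memv_img ?memvf.
Qed.

(** A quasi-isomorphism is bijective on cohomology, so a formal inverse can be sent to an actual
    chain map. Hence [coh_map] takes values in chain maps, which can be evaluated on elements. *)
Definition coh_inv X Y (s : chain X Y) (sq : qis s) : chain (coh Y) (coh X) :=
  cinv (coh_chain_inj sq) (coh_chain_sur sq).

Fixpoint trunc_map X Y (e : dhom X Y) : dhom (trunc X) (trunc Y) :=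
  match e with
  | Qd _ _ f => Qd (trunc_chain f)
  | dinv _ _ _ sq => dinv (trunc_qis sq)
  | dcomp _ _ _ e1 e2 => dcomp (trunc_map e1) (trunc_map e2)
  | dadd _ _ e1 e2 => dadd (trunc_map e1) (trunc_map e2)
  | dscale _ _ c e1 => dscale c (trunc_map e1)
  end.

Fixpoint coh_map X Y (e : dhom X Y) : chain (coh X) (coh Y) :=
  match e with
  | Qd _ _ f => coh_chain f
  | dinv _ _ _ sq => coh_inv sq
  | dcomp _ _ _ e1 e2 => ccomp (coh_map e1) (coh_map e2)
  | dadd _ _ e1 e2 => cadd (coh_map e1) (coh_map e2)
  | dscale _ _ c e1 => cscale c (coh_map e1)
  end.

End Truncation.

(** * Cohomology as a functor on the derived category *)

Section CohomologyFunctor.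
Variables (k : fieldType) (G : zmodType) (A : galg k G) (n : int).
Implicit Types X Y Z : cplx A.

Lemma cohP X i (y : coh n X i) :
  exists2 x, x \in trK n X i & y = sqproj (trK n X i) (trL n X i) x.
Proof. exact: sqcplxP. Qed.

Lemma coh_chain_id X i y : coh_chain n (Defs.cid X) i y = y.
Proof.
have [x xK ->] := cohP y.
by rewrite coh_chainE // cidE.
Qed.

Lemma coh_chain_comp X Y Z (g : chain Y Z) (f : chain X Y) i y :
  coh_chain n (ccomp g f) i y = coh_chain n g i (coh_chain n f i y).
Proof.
have [x xK ->] := cohP y.
by rewrite !coh_chainE ?chain_trK // ccompE.
Qed.

Lemma coh_chain_zero X Y i y : coh_chain n (czero X Y) i y = 0.
Proof. by have [x xK ->] := cohP y; rewrite coh_chainE // czeroE linear0. Qed.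

Lemma coh_chain_add X Y (f g : chain X Y) i y :
  coh_chain n (cadd f g) i y = coh_chain n f i y + coh_chain n g i y.
Proof.
have [x xK ->] := cohP y.
by rewrite !coh_chainE // caddE linearD.
Qed.

Lemma coh_chain_scale X Y c (f : chain X Y) i y :
  coh_chain n (cscale c f) i y = c *: coh_chain n f i y.
Proof.
have [x xK ->] := cohP y.
by rewrite !coh_chainE // cscaleE linearZ.
Qed.

Lemma coh_map_comp X Y Z (e1 : dhom Y Z) (e2 : dhom X Y) i y :
  coh_map n (dcomp e1 e2) i y = coh_map n e1 i (coh_map n e2 i y).
Proof. exact: comp_lfunE. Qed.

(** Makes cohomology well defined on the derived category. Each generating relation of [~=] is
    checked on elements; the two for formal inverses hold by bijectivity on cohomology. *)
Lemma coh_map_equiv X Y (e e' : dhom X Y) : e ~= e' ->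
  forall i y, coh_map n e i y = coh_map n e' i y.
Proof.
elim=> {X Y e e'} [X Y e|X Y e e' _ IH|X Y e1 e2 e3 _ IH1 _ IH2
  |X Y Z e1 e1' e2 e2' _ IH1 _ IH2|X Y e1 e1' e2 e2' _ IH1 _ IH2|X Y c e e' _ IH
  |X Y Z W e1 e2 e3|X Y e|X Y e|X Y e1 e2 e3|X Y e1 e2|X Y e|X Y e|X Y a b e|X Y e
  |X Y a e1 e2|X Y a b e|X Y Z e1 e2 e|X Y Z e e1 e2|X Y Z a e1 e2|X Y Z a e1 e2
  |X Y f g fg|X Y Z g f|X Y f g|X Y c f|X Y s sq|X Y s sq] i y /=.
- by [].
- by rewrite IH.
- by rewrite IH1 IH2.
- by rewrite !comp_lfunE IH2 IH1.
- by rewrite !add_lfunE IH1 IH2.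
- by rewrite !scale_lfunE IH.
- by rewrite !comp_lfunE.
- by rewrite comp_lfunE coh_chain_id.
- by rewrite comp_lfunE coh_chain_id.
- by rewrite !add_lfunE addrA.
- by rewrite !add_lfunE addrC.
- by rewrite add_lfunE coh_chain_zero add0r.
- by rewrite add_lfunE coh_chain_zero scale_lfunE scaleN1r addNr.
- by rewrite !scale_lfunE scalerA.
- by rewrite scale_lfunE scale1r.
- by rewrite !(add_lfunE, scale_lfunE) scalerDr.
- by rewrite !(add_lfunE, scale_lfunE) scalerDl.
- by rewrite !(add_lfunE, comp_lfunE).
- by rewrite !(add_lfunE, comp_lfunE) linearD.
- by rewrite !(scale_lfunE, comp_lfunE).
- by rewrite !(scale_lfunE, comp_lfunE) linearZ.
- have [x xK ->] := cohP y.
  by rewrite !coh_chainE // fg.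
- by rewrite comp_lfunE coh_chain_comp.
- by rewrite add_lfunE coh_chain_add.
- by rewrite scale_lfunE coh_chain_scale.
- by rewrite comp_lfunE coh_chain_id (chainK (coh_chain_inj sq)).
- by rewrite comp_lfunE coh_chain_id (chainVK (coh_chain_inj sq) (coh_chain_sur sq)).
Qed.

Definition pm_trunc : premap A A.
Proof.
refine (@PreMap k G A A (trunc n) (@trunc_map k G A n) _ _ _ _ _) => //=.
- by move=> X Y s sq; apply: de_invl.
- by move=> X Y s sq; apply: de_invr.
Defined.

Definition pm_coh : premap A A.
Proof.
refine (@PreMap k G A A (coh n) (fun X Y e => Qd (coh_map n e)) _ _ _ _ _) => /=.
- by move=> *; apply: de_Qcomp.
- by move=> *; apply: de_Qadd.
- by move=> *; apply: de_Qscale.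
- move=> X Y s sq; apply: Qd_eq => i x.
  by rewrite (chainK (coh_chain_inj sq)) id_lfunE.
- move=> X Y s sq; apply: Qd_eq => i x.
  by rewrite (chainVK (coh_chain_inj sq) (coh_chain_sur sq)) id_lfunE.
Defined.

Lemma trunc_map_incl X Y (e : dhom X Y) :
  dcomp (Qd (trunc_incl n Y)) (trunc_map n e) ~= dcomp e (Qd (trunc_incl n X)).
Proof.
apply: (@pm_natural _ _ _ _ pm_trunc (pm_id A) (fun X => Qd (trunc_incl n X))).
move=> {e}X {}Y f /=.
by apply: Qd_square => i y; apply: trunc_incl_natural.
Qed.

Lemma trunc_map_coh X Y (e : dhom X Y) :
  dcomp (Qd (trunc_coh n Y)) (trunc_map n e)
    ~= dcomp (Qd (coh_map n e)) (Qd (trunc_coh n X)).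
Proof.
apply: (@pm_natural _ _ _ _ pm_trunc pm_coh (fun X => Qd (trunc_coh n X))).
move=> {e}X {}Y f /=.
by apply: Qd_square => i y; apply: trunc_coh_natural.
Qed.

(** Exactness is stated in degree [i + 1] to have both differentials at hand; as [i] runs over all
    integers, every degree but [n] is covered. *)
Definition coh_conc X : Prop := forall i, i + 1 != n ->
  forall x : X (i + 1), diff X (i + 1) x = 0 -> exists y, x = diff X i y.

Lemma trunc_incl_diff X i (y : trunc n X i) :
  trunc_incl n X (i + 1) (diff (trunc n X) i y) = diff X i (trunc_incl n X i y).
Proof. exact: chain_diff. Qed.

Lemma trunc_incl_inj X i : injective (trunc_incl n X i).
Proof. exact: sub_incl_inj. Qed.

Lemma truncP X i (y : trunc n X i) :
  exists2 x, x \in trK n X i & y = sqproj (trK n X i) 0%VS x.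
Proof. exact: sqcplxP. Qed.

Lemma trunc_diffE X i x : x \in trK n X i ->
  diff (trunc n X) i (sqproj (trK n X i) 0%VS x)
    = sqproj (trK n X (i + 1)) 0%VS (diff X i x).
Proof. by move=> xK; rewrite [LHS]sqdiffE. Qed.

(** Above [n] exactness supplies the missing primitives; up to [n] truncation changes neither
    cocycles nor boundaries. *)
Lemma trunc_incl_qis X : coh_conc X -> qis (trunc_incl n X).
Proof.
move=> Xn i; split=> [y dy [x E]|x dx].
  have [lt|le] := ltP n (i + 1).
    have [z zK ->] := truncP y; exists 0.
    by rewrite (trK_gt0 lt zK) !linear0.
  have xK : x \in trK n X i by rewrite trK_lt ?memvf //; lia.
  exists (sqproj (trK n X i) 0%VS x); apply: trunc_incl_inj.
  by rewrite trunc_incl_diff E trunc_inclE.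
have [lt|gt|eq] := ltgtP (i + 1) n.
- have xK : x \in trK n X (i + 1) by rewrite trK_lt ?memvf.
  exists (sqproj (trK n X (i + 1)) 0%VS x); first by rewrite trunc_diffE // dx linear0.
  by exists 0; rewrite trunc_inclE // linear0 addr0.
- exists 0; first by rewrite linear0.
  have [|x' ->] := Xn i _ x dx; first by rewrite gt_eqF.
  by exists x'; rewrite linear0 add0r.
- have xK : x \in trK n X (i + 1) by rewrite trK_n // memv_ker dx.
  exists (sqproj (trK n X (i + 1)) 0%VS x); first by rewrite trunc_diffE // dx linear0.
  by exists 0; rewrite trunc_inclE // linear0 addr0.
Qed.

(** Below [n] the truncation is exact and the target zero; in degree [n] the map divides out the
    boundaries. *)
Lemma trunc_coh_qis X : coh_conc X -> qis (trunc_coh n X).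
Proof.
move=> Xn i; split=> [y dy [z E]|z dz]; last first.
  have [ne|eq] := eqVneq (i + 1) n; last first.
    by exists 0; rewrite ?linear0 // (coh_eq0 z eq); exists 0; rewrite !linear0 addr0.
  have [x xK ->] := cohP z; exists (sqproj (trK n X (i + 1)) 0%VS x).
    by rewrite trunc_diffE // (trK_ker ne xK) linear0.
  by exists 0; rewrite linear0 addr0 trunc_cohE.
have [lt|le] := ltP n (i + 1).
  have [x xK ->] := truncP y; exists 0.
  by rewrite (trK_gt0 lt xK) !linear0.
suff [x E'] : exists x, trunc_incl n X (i + 1) y = diff X i x.
  have xK : x \in trK n X i by rewrite trK_lt ?memvf //; lia.
  exists (sqproj (trK n X i) 0%VS x); apply: trunc_incl_inj.
  by rewrite trunc_incl_diff E' trunc_inclE.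
have [eq|ne] := eqVneq (i + 1) n; last first.
  by apply: Xn => //; rewrite -trunc_incl_diff dy linear0.
move: E; have [x xK -> E] := truncP y; rewrite trunc_inclE //.
move: E; rewrite trunc_cohE // (coh_eq0 z) ?linear0; last by rewrite lt_eqF //; lia.
move=> /(sqproj_eq0 xK); rewrite trL_n // bndS => /memv_imgP[x' _ ->].
by exists x'.
Qed.

(** The truncation maps quasi-isomorphically both to the complex and to its cohomology placed in
    degree [n], naturally in each case. A morphism is therefore recovered from its effect on
    cohomology. *)
Lemma coh_map_faithful X Y (e e' : dhom X Y) : coh_conc X -> coh_conc Y ->
  (forall y, coh_map n e n y = coh_map n e' n y) -> e ~= e'.
Proof.
move=> Xn Yn E.
have Q : Qd (coh_map n e) ~= Qd (coh_map n e').
  apply: chain_eqP => i y; case: (eqVneq i n) y => [->|ne] y; first exact: E.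
  by rewrite (coh_eq0 y ne) !linear0.
have [tX [_ iX]] := diso_qis (trunc_incl_qis Xn).
have [cY [jY _]] := diso_qis (trunc_coh_qis Yn).
(* The inclusion is cancelled on the source, then the passage to cohomology on the target. *)
apply: (depiP iX); rewrite -!trunc_map_incl; apply: de_comp => //.
by apply: (dmonoP jY); rewrite !trunc_map_coh Q.
Qed.

End CohomologyFunctor.

(** * Complexes with cohomology in a single degree *)

Section Concentration.
Variables (k : fieldType) (G : zmodType) (A : galg k G).
Implicit Types X Y Z : cplx A.

(** Expressed through [coh], which is functorial on the derived category, concentration is visibly
    invariant under isomorphism. *)
Lemma coh_conc_P n X :
  coh_conc n X <-> forall m, m != n -> forall y : coh m X m, y = 0.
Proof.
split=> [Xn m mn y|X0 i ne x dx].
  have [x xK ->] := cohP y; apply: sqproj0; rewrite trL_n //.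
  move: (trK_ker (erefl m) xK) mn => {y xK}; have [j jm] := int_predP m.
  move: x; rewrite jm => x dx ne; have [y ->] := Xn j ne x dx.
  by rewrite bndS memv_img ?memvf.
have xK : x \in trK (i + 1) X (i + 1) by rewrite trK_n // memv_ker dx.
have := X0 _ ne (sqproj (trK (i + 1) X (i + 1)) (trL (i + 1) X (i + 1)) x).
move=> /(sqproj_eq0 xK); rewrite trL_n // bndS => /memv_imgP[y _ ->].
by exists y.
Qed.

Lemma coh_conc_diso n X Y : disomorphic X Y -> coh_conc n X -> coh_conc n Y.
Proof.
move=> [a [b [_ ab]]] /coh_conc_P Xn; apply/coh_conc_P => m mn y.
have := @coh_map_equiv _ _ _ m _ _ _ _ ab m y; rewrite /= comp_lfunE coh_chain_id => <-.
by rewrite (Xn m mn (coh_map m b m y)) linear0.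
Qed.

Lemma coh_conc_Pi n g X : coh_conc n X -> coh_conc n (Pi_cplx g X).
Proof. by []. Qed.

Lemma coh_conc_sh n X : coh_conc n (sh_cplx X) <-> coh_conc (n + 1) X.
Proof.
split=> Xn i ne x dx.
  have [j ji] := int_predP i; move: ne x dx; rewrite ji => ne x dx.
  have [||y ->] := Xn j _ x.
  - by move: ne; rewrite (inj_eq (addIr _)).
  - by rewrite /= opp_lfunE dx oppr0.
  by exists (- y); rewrite /= opp_lfunE linearN.
have [||y E] := Xn (i + 1) _ x.
- by rewrite (inj_eq (addIr _)).
- by apply/eqP; rewrite -oppr_eq0 -opp_lfunE; apply/eqP.
by exists (- y); rewrite /= opp_lfunE linearN opprK.
Qed.

Lemma concentrated_coh_conc n X : concentrated_in n X -> coh_conc n X.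
Proof. by move=> Xn i ne x _; exists 0; rewrite linear0 (Xn _ ne x). Qed.

Lemma quasi_isomorphic_diso X Y : quasi_isomorphic X Y -> disomorphic X Y.
Proof.
elim=> {X Y} [X|X Y Z s sq _ IH|X Y Z s sq _ IH]; first exact: disomorphic_refl.
  exact: disomorphic_trans (qis_disomorphic sq) IH.
exact: disomorphic_trans (disomorphic_sym (qis_disomorphic sq)) IH.
Qed.

Lemma one_degree_coh_conc X : one_degree X -> exists n, coh_conc n X.
Proof.
move=> [n [Y [/concentrated_coh_conc Yn /quasi_isomorphic_diso XY]]]; exists n.
exact: coh_conc_diso (disomorphic_sym XY) Yn.
Qed.

End Concentration.

(** * The action of the graded centre *)

Section CentralAction.
Variables (k : fieldType) (G : zmodType) (A : galg k G).
Implicit Types (M N : gmod A) (X Y : cplx A) (x y : fun_alg A).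

Record is_hcentral (g : G) (x : fun_alg A) : Prop := IsHCentral {
  hcentral_gcentral : is_gcentral x;
  hcentral_deg : forall l, x l \in ahom_part A g
}.

Definition lact M (a : A) : 'End(M) := lfun_of (@act_linearr _ _ _ M a).
Definition ract M (m : M) : 'Hom(A, M) := lfun_of (@act_linearl _ _ _ M m).

Lemma lactE M (a : A) (m : M) : lact M a m = act a m. Proof. exact: lfun_ofE. Qed.
Lemma ractE M (a : A) (m : M) : ract m a = act a m. Proof. exact: lfun_ofE. Qed.

(* The sign makes [emul] commute with the action, see [emul_act]: an element of
   degree [h] moves the index of [x] by [h]. *)
Definition emul M x : 'End(M) := gextend (gmod_grading M) (fun l => lact M (x (- l))).

Lemma emulE M x l m : m \in hom_part M l -> emul M x m = act (x (- l)) m.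
Proof. by move=> ml; rewrite /emul (gextendE _ _ ml) lactE. Qed.

Lemma emul_natural M N (f : 'Hom(M, N)) x m : is_gmor f ->
  f (emul M x m) = emul N x (f m).
Proof.
move=> fM; rewrite -!comp_lfunE; apply: (congr1 (fun F : 'Hom(M, N) => F m)).
apply: (grading_eq_lfun (gmod_grading M)) => l {}m ml.
rewrite !comp_lfunE (emulE _ ml) (gmor_act fM) (emulE _ (l := l)) //.
exact: (gmor_grade fM).
Qed.

(** Both sides are linear in [a] and in [m]. For homogeneous [a] and [m] of degrees [h] and [l],
    centrality at the index [- (h + l)] moves [a] to the left and changes the index to [- l]. *)
Lemma emul_act M x (a : A) m : is_gcentral x -> emul M x (act a m) = act a (emul M x m).
Proof.
move=> xZ; rewrite -!lactE -!comp_lfunE; apply: (congr1 (fun F : 'End(M) => F m)).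
apply: (grading_eq_lfun (gmod_grading M)) => l {}m ml.
rewrite !comp_lfunE !lactE -!ractE -!comp_lfunE.
have -> : ract (emul M x m) a = act a (act (x (- l)) m) by rewrite ractE (emulE _ ml).
rewrite -act_mul comp_lfunE ractE.
(* Both sides become linear maps in [a], to be compared on homogeneous elements; [lact M 1] is the
   identity. *)
suff E : (emul M x \o ract m)%VF = (lact M 1 \o ract (act (x (- l)) m))%VF.
  by have := congr1 (fun F : 'Hom(A, M) => F a) E; rewrite !comp_lfunE !ractE lactE act_one act_mul.
apply: (grading_eq_lfun (galg_grading A)) => h {}a ah.
rewrite !comp_lfunE !ractE lactE act_one (emulE _ (act_grade ah ml)) -!act_mul.
by rewrite (xZ _ _ _ ah) opprD addrAC addNr add0r.
Qed.

Lemma emul_gmor g x M : is_hcentral g x -> @is_gmor _ _ A M (gshift g M) (emul M x).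
Proof.
move=> [xZ xg]; split=> [a m|l m ml]; first exact: (emul_act a m xZ).
by rewrite (emulE _ ml) /= addrC; apply: act_grade.
Qed.

Program Definition eta g x (xh : is_hcentral g x) X : chain X (Pi_cplx g X) :=
  @Chain _ _ _ X (Pi_cplx g X) (fun i => emul (X i) x) _ _.
Next Obligation. by move=> g x xh X i; apply: emul_gmor. Qed.
Next Obligation.
by move=> g x xh X i m; rewrite (emul_natural _ _ (diff_gmor X i)).
Qed.

Lemma etaE g x (xh : is_hcentral g x) X i m : eta xh X i m = emul (X i) x m.
Proof. by []. Qed.

Lemma eta_natural g x (xh : is_hcentral g x) X Y (e : dhom X Y) :
  dcomp (Qd (eta xh Y)) e ~= dcomp (dPi g e) (Qd (eta xh X)).
Proof.
apply: (@pm_natural _ _ _ _ (pm_id A) (pm_Pi A g) (fun X => Qd (eta xh X))).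
move=> {e}X {}Y f; apply: Qd_square => i m; rewrite !etaE.
by rewrite [RHS](emul_natural _ _ (chain_gmor f i)).
Qed.

Lemma emul_one M m : emul M 1 m = m.
Proof.
suff -> : emul M 1 = \1%VF by rewrite lfunE.
apply: (grading_eq_lfun (gmod_grading M)) => l {}m ml.
by rewrite (emulE _ ml) lfunE act_one.
Qed.

(** [y] raises degrees by [h], and [gshift h M] lowers them again, so both factors are evaluated at
    the same index. *)
Lemma emul_mul h M x y m : (forall l, y l \in ahom_part A h) ->
  emul M (x * y) m = emul (gshift h M) x (emul M y m).
Proof.
move=> yh; rewrite -!comp_lfunE.
suff -> : emul M (x * y) = (emul (gshift h M) x \o emul M y)%VF by [].
apply: (grading_eq_lfun (gmod_grading M)) => l {}m ml.
rewrite comp_lfunE !(emulE _ ml) (emulE _ (l := l)); first exact: act_mul.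
by rewrite /= addrC; apply: act_grade.
Qed.

Lemma emul_lin M c x y m : emul M (c *: x + y) m = c *: emul M x m + emul M y m.
Proof.
rewrite -scale_lfunE -add_lfunE; apply: (congr1 (fun F : 'End(M) => F m)).
apply: (grading_eq_lfun (gmod_grading M)) => l {}m ml.
by rewrite add_lfunE scale_lfunE !(emulE _ ml) -act_linearl.
Qed.

Definition tau (h : G) (x : fun_alg A) : fun_alg A := fun l => x (l + h).

Lemma tau_hcentral h g x : is_hcentral g x -> is_hcentral g (tau h x).
Proof.
move=> [xZ xg]; split=> [l l' a al'|l]; last exact: xg.
by rewrite /tau (xZ _ _ _ al') addrAC.
Qed.

(** Degree [l] of the shift is degree [l + h] of [M], and [- l = - (l + h) + h]. *)
Lemma emul_shift h M x m : emul (gshift h M) x m = emul M (tau h x) m.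
Proof.
suff -> : emul (gshift h M) x = emul M (tau h x) by [].
apply: (grading_eq_lfun (gmod_grading (gshift h M))) => l {}m ml.
rewrite [LHS](emulE _ ml) [RHS](@emulE M _ (l + h) m ml) /tau.
by rewrite opprD addrNK.
Qed.

End CentralAction.

(** * Shifts of the regular module *)

Section Free.
Variables (k : fieldType) (G : zmodType) (A : galg k G).
Implicit Types (X Y : cplx A).

(** The regular module in cohomological degree [n] is cut out by subspaces of one fixed module,
    which keeps case distinctions on the degree out of the types. *)
Definition freeK (n i : int) : {vspace regular A} := if i == n then fullv else 0%VS.

Lemma gsub_freeK n i : is_gsub (freeK n i).
Proof. by rewrite /freeK; case: eqP => _; [apply: gsub_full|apply: gsub_zero]. Qed.

Lemma freeK_neq n i x : i != n -> x \in freeK n i -> x \in (0 : {vspace regular A})%VS.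
Proof. by rewrite /freeK => /negPf ->. Qed.

Program Definition cfree n : cplx A :=
  @Cplx _ _ _ (fun i => gsq (gsub_freeK n i) (gsub_zero (regular A))) (fun i => 0) _ _ _.
Next Obligation. by move=> *; apply: gmor_zero. Qed.
Next Obligation. by move=> *; rewrite zero_lfunE. Qed.
Next Obligation.
move=> n; exists n, n => i; rewrite -neq_lt => /negPf ne x.
by rewrite -[x]sqvalK; apply: sqproj0; apply: freeK_neq (sqval_in x); rewrite ne.
Qed.

Lemma free_in n (a : A) : a \in freeK n n.
Proof. by rewrite /freeK eqxx memvf. Qed.

Definition emb n (a : A) : cfree n n := sqproj (freeK n n) 0%VS a.

(* [m], extended by zero to all degrees *)
Definition pt n X (m : X n) (i : int) : X i :=
  match n =P i with
  | ReflectT e => ecast j (X j) e m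
  | ReflectF _ => 0
  end.

Lemma pt_n n X (m : X n) : pt m n = m.
Proof. by rewrite /pt; case: eqP => // e; rewrite eq_axiomK. Qed.

Lemma pt_ind n X (m : X n) (P : forall i, X i -> Prop) :
  P n m -> (forall i, P i 0) -> forall i, P i (pt m i).
Proof. by move=> Pm P0 i; rewrite /pt; case: eqP => // e; case: _ / e. Qed.

Definition free_map n X (m : X n) i : 'Hom(cfree n i, X i) :=
  (ract (pt m i) \o sqval (freeK n i) 0%VS)%VF.

Lemma free_mapE n X (m : X n) i y :
  free_map m i y = act (sqval (freeK n i) 0%VS y) (pt m i).
Proof. by rewrite comp_lfunE ractE. Qed.

Section FreeMap.
Variables (n : int) (h : G) (X : cplx A) (m : X n).
Hypotheses (dm : diff X n m = 0) (mh : m \in hom_part (X n) (- h)).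

(** The shift by [h] puts the generator in degree [- h], so a homogeneous cocycle [m] of that degree
    determines a chain map sending the generator to [m]. *)
Program Definition free_chain : chain (Pi_cplx h (cfree n)) X :=
  @Chain _ _ _ (Pi_cplx h (cfree n)) X
    (fun i => free_map m i) _ _.
Next Obligation.
move=> i; split=> [a y|l y /sqpartP[x [xA xK ->]]]; rewrite !free_mapE.
  have yK := sqval_in y; rewrite -act_mul; congr (act _ _).
  exact: sqproj0K (gsub_act (gsub_freeK n i) a yK).
have pi : pt m i \in hom_part (X i) (- h).
  by apply: (pt_ind (P := fun i p => p \in hom_part (X i) (- h))) => // j; apply: mem0v.
by rewrite sqproj0K //; have := act_grade xA pi; rewrite /= addrK.
Qed.
Next Obligation.
move=> i y; rewrite /= zero_lfunE linear0 free_mapE.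
rewrite (gmor_act (diff_gmor X i)); apply/esym.
rewrite [X in act _ X](_ : _ = 0) ?act0 //.
by apply: (pt_ind (P := fun i p => diff X i p = 0)) => // j; apply: linear0.
Qed.

Lemma free_chainE a : free_chain n (emb n a) = act a m.
Proof. by rewrite [LHS]free_mapE pt_n sqproj0K ?free_in. Qed.

End FreeMap.

Lemma emb_in n h l (a : A) : a \in ahom_part A (l + h) ->
  (emb n a : Pi_cplx h (cfree n) n) \in hom_part (Pi_cplx h (cfree n) n) l.
Proof. by move=> al; apply/sqpartP; exists a; rewrite free_in. Qed.

Lemma embP n h l (y : Pi_cplx h (cfree n) n) : y \in hom_part (Pi_cplx h (cfree n) n) l ->
  exists2 a : A, a \in ahom_part A (l + h) & y = emb n a.
Proof. by move=> /sqpartP[a [al _ ->]]; exists a. Qed.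

Lemma act_emb n h (a b : A) :
  act a (emb n b : Pi_cplx h (cfree n) n) = (emb n (a * b) : Pi_cplx h (cfree n) n).
Proof. exact: (sqact_proj (gsub_zero (regular A)) a (free_in n b)). Qed.

Lemma emb_inj n : injective (emb n).
Proof.
move=> a b E; rewrite -(sqproj0K (free_in n a)) -(sqproj0K (free_in n b)).
by rewrite [LHS](congr1 _ E).
Qed.

Lemma diff_free n h i x : diff (Pi_cplx h (cfree n)) i x = 0.
Proof. exact: zero_lfunE. Qed.

Lemma free_coh_conc n h : coh_conc n (Pi_cplx h (cfree n)).
Proof.
apply: concentrated_coh_conc => i ne x.
rewrite -[x]sqvalK; apply: (@sqproj0 _ _ _ (regular A)).
exact: freeK_neq ne (sqval_in x).
Qed.

(** * Natural families of morphisms to a shift, computed on cohomology classes *)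

Section Classes.
Variables (n : int).

Definition cl X (m : X n) : coh n X n := sqproj (trK n X n) (trL n X n) m.

Arguments cl : clear implicits.

Lemma cl_in X (m : X n) : diff X n m = 0 -> m \in trK n X n.
Proof. by move=> dm; rewrite trK_n // memv_ker dm. Qed.

Lemma cl_chain X Y (f : chain X Y) m : diff X n m = 0 ->
  coh_chain n f n (cl X m) = cl Y (f n m).
Proof. by move=> /cl_in; apply: coh_chainE. Qed.

Lemma cl_act X (a : A) m : diff X n m = 0 -> act a (cl X m) = cl X (act a m).
Proof. by move=> /cl_in; apply: (sqact_proj (gsub_trL n X n)). Qed.

Lemma cl_inj X (m m' : X n) : (forall i x, diff X i x = 0) -> cl X m = cl X m' -> m = m'.
Proof.
move=> d0 /eqP; rewrite -subr_eq0 -linearB => /eqP.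
move=> /(sqproj_eq0 (cl_in (d0 _ _))); rewrite trL_n // => mb.
suff bnd0 i x : x \in bnd X i -> x = 0 by apply/eqP; rewrite -subr_eq0; apply/eqP/bnd0.
have [j ji] := int_predP i; move: x; rewrite ji => x.
by rewrite bndS => /memv_imgP[y _ ->]; apply: d0.
Qed.

Section Family.
Variables (g : G) (w : forall X, dhom X (Pi_cplx g X)).
Hypothesis w_natural : forall X Y (f : chain X Y),
  dcomp (w Y) (Qd f) ~= dcomp (Qd (Pi_chain g f)) (w X).

(** The generator has degree [- h]; so has the class of its image, and undoing the two shifts gives
    a representative of degree [- h + g + h = g] in [A]. *)
Lemma family_free : exists z : fun_alg A, (forall l, z l \in ahom_part A g) /\
  forall h, coh_map n (w (Pi_cplx h (cfree n))) n (cl (Pi_cplx h (cfree n)) (emb n 1))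
    = cl (Pi_cplx g (Pi_cplx h (cfree n))) (emb n (z h)).
Proof.
suff /choice[z zP] : forall h, exists z : A, z \in ahom_part A g /\
    coh_map n (w (Pi_cplx h (cfree n))) n (cl (Pi_cplx h (cfree n)) (emb n 1))
      = cl (Pi_cplx g (Pi_cplx h (cfree n))) (emb n z).
  by exists z; split=> h; have [] := zP h.
move=> h; set P := Pi_cplx h (cfree n).
have uh : cl P (emb n 1) \in hom_part (coh n P n) (- h).
  apply/sqpartP; exists (emb n 1); split=> //; last exact/cl_in/diff_free.
  by apply: emb_in; rewrite addNr; apply: galg_one.
have /sqpartP[x [xg xK ->]] := gmor_grade (chain_gmor (coh_map n (w P)) n) uh.
have [|z zg ->] := @embP n h (- h + g) x; first exact: xg.
by exists z; split=> //; move: zg; rewrite addrAC addNr add0r.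
Qed.

(** A homogeneous cocycle is the image of the generator of a shifted regular module, so naturality
    computes [w] on its class. Comparing this formula with linearity on the regular module yields
    centrality. *)
Lemma family_class : exists z : fun_alg A, is_hcentral g z /\
  forall X m l, diff X n m = 0 -> m \in hom_part (X n) l ->
    coh_map n (w X) n (cl X m) = cl (Pi_cplx g X) (act (z (- l)) m : X n).
Proof.
have [z [zg zP]] := family_free; exists z.
suff H X m l : diff X n m = 0 -> m \in hom_part (X n) l ->
    coh_map n (w X) n (cl X m) = cl (Pi_cplx g X) (act (z (- l)) m : X n).
  (* In the shift by [l + h] the vector [emb n a] has degree [- l]. Its image is given by [z l * a]
     through the formula and by [a * z (l + h)] through linearity. *)
  split=> //; split=> // l h a ah; set P := Pi_cplx (l + h) (cfree n).
  have a_in : (emb n a : P n) \in hom_part (P n) (- l).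
    by apply: emb_in; rewrite addrA addNr add0r.
  have := H P (emb n a) (- l) (diff_free _) a_in.
  have -> : cl P (emb n a) = act a (cl P (emb n 1)).
    by rewrite (cl_act _ (diff_free _)) act_emb mulr1.
  rewrite (gmor_act (chain_gmor (coh_map n (w P)) n)) zP opprK.
  rewrite (@cl_act (Pi_cplx g P) a (emb n (z (l + h))) (diff_free _)).
  have -> : act (z l) (emb n a : P n) = emb n (z l * a) by apply: act_emb.
  have -> : act a (emb n (z (l + h)) : Pi_cplx g P n) = emb n (a * z (l + h)).
    exact: act_emb.
  have d0 i x : diff (Pi_cplx g P) i x = 0 by apply: diff_free.
  by move=> /(cl_inj d0) E; exact: (@emb_inj n _ _ (esym E)).
move=> dm ml; have ml' : m \in hom_part (X n) (- - l) by rewrite opprK.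
have [p pE] : exists p : chain (Pi_cplx (- l) (cfree n)) X,
    forall a, p n (emb n a) = act a m.
  by exists (free_chain dm ml') => a; apply: free_chainE.
set P := Pi_cplx (- l) (cfree n) in p pE *.
have E : coh_map n (w X) n (coh_chain n p n (cl P (emb n 1)))
       = coh_chain n (Pi_chain g p) n (coh_map n (w P) n (cl P (emb n 1))).
  have H := @coh_map_equiv _ _ _ n _ _ _ _ (w_natural p) n (cl P (emb n 1)).
  apply: etrans (esym (coh_map_comp (w X) (Qd p) _)) _.
  exact: etrans H (coh_map_comp (Qd (Pi_chain g p)) (w P) _).
have d0 x : diff P n x = 0 by apply: diff_free.
have E1 : coh_chain n p n (cl P (emb n 1)) = cl X m.
  exact: etrans (cl_chain p (d0 _)) (congr1 (cl X) (etrans (pE 1) (act_one m))).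
apply: etrans (congr1 (coh_map n (w X) n) (esym E1)) _; apply: etrans E _.
apply: etrans (congr1 (coh_chain n (Pi_chain g p) n) (zP (- l))) _.
exact: etrans (@cl_chain _ _ (Pi_chain g p) _ (d0 _)) (congr1 (cl (Pi_cplx g X)) (pE _)).
Qed.

(** The formula on classes becomes an equality of morphisms, as cohomology is faithful on these
    complexes. *)
Lemma family_eta : exists z (zh : is_hcentral g z),
  forall X, coh_conc n X -> w X ~= Qd (eta zh X).
Proof.
have [z [zh zP]] := family_class; exists z, zh => X Xn.
apply: (coh_map_faithful (n := n)) => // y.
suff E : coh_map n (w X) n = coh_chain n (eta zh X) n.
  exact: (congr1 (fun F : 'Hom(coh n X n, coh n (Pi_cplx g X) n) => F y) E).
apply: (grading_eq_lfun (gmod_grading (coh n X n))) => l _ /sqpartP[m [ml mK ->]].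
have dm : diff X n m = 0 by apply: trK_ker mK.
apply: etrans (zP X m l dm ml) _; apply: etrans _ (esym (cl_chain (eta zh X) dm)).
by congr (cl _ _); rewrite etaE (emulE _ ml).
Qed.

End Family.

(** The generator of the shift by [h] has degree [- h], so the action of [z] on it reads off
    [z h]. *)
Lemma eta_inj g z z' (zh : is_hcentral g z) (zh' : is_hcentral g z') :
  (forall h, Qd (eta zh (Pi_cplx h (cfree n))) ~= Qd (eta zh' (Pi_cplx h (cfree n)))) ->
  z = z'.
Proof.
move=> E; apply/funext => h; set P := Pi_cplx h (cfree n).
have dP : diff P n (emb n 1) = 0 by apply: diff_free.
have H := @coh_map_equiv _ _ _ n _ _ _ _ (E h) n (cl P (emb n 1)).
have {}H : cl (Pi_cplx g P) (emul (P n) z (emb n 1)) = cl (Pi_cplx g P) (emul (P n) z' (emb n 1)).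
  apply: etrans (esym (cl_chain (eta zh P) dP)) _.
  exact: etrans H (cl_chain (eta zh' P) dP).
have d0 i x : diff (Pi_cplx g P) i x = 0 by apply: diff_free.
have emb1 : (emb n 1 : P n) \in hom_part (P n) (- h).
  by apply: emb_in; rewrite addNr; apply: galg_one.
have embE y : emul (P n) y (emb n 1) = emb n (y h).
  by rewrite (emulE _ emb1) opprK; rewrite [LHS](@act_emb n h (y h) 1) mulr1.
move: H => /(cl_inj d0); rewrite !embE; exact: emb_inj.
Qed.

End Classes.
End Free.

(** * Graded functors *)

Section Shifts.
Variables (k : fieldType) (G : zmodType) (A : galg k G).
Implicit Types X Y : cplx A.

Lemma diso_bij X Y (s : chain X Y) :
  (forall i, injective (s i)) -> (forall i y, exists x, y = s i x) -> diso (Qd s).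
Proof. by move=> inj sur; apply/diso_qis/qis_bij. Qed.

Lemma diso_lr X Y (a : dhom X Y) (b c : dhom Y X) :
  dcomp b a ~= did X -> dcomp a c ~= did Y -> diso a.
Proof.
move=> ba ac; exists b; split=> //.
suff -> : b ~= c by [].
by rewrite -(de_comp_id b) -ac de_compA ba de_id_comp.
Qed.

Lemma PiDE l h X i x : PiD l h X i x = x. Proof. exact: id_lfunE. Qed.
Lemma Pi0E X i x : Pi0 X i x = x. Proof. exact: id_lfunE. Qed.

Lemma diso_PiD l h X : diso (Qd (PiD l h X)).
Proof.
apply: diso_bij => i; first by move=> x y; rewrite !PiDE.
by move=> y; exists y; rewrite PiDE.
Qed.

Lemma diso_Pi0 X : diso (Qd (Pi0 X)).
Proof.
apply: diso_bij => i; first by move=> x y; rewrite !Pi0E.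
by move=> y; exists y; rewrite Pi0E.
Qed.

Lemma dPi_comp g X Y Z (b : dhom Y Z) (a : dhom X Y) :
  dPi g (dcomp b a) ~= dcomp (dPi g b) (dPi g a).
Proof. by []. Qed.

Lemma dPi_id g X : dPi g (did X) ~= did (Pi_cplx g X).
Proof. exact: chain_eqP. Qed.

Lemma dPi_diso g X Y (a : dhom X Y) : diso a -> diso (dPi g a).
Proof. exact: (@dF_diso _ _ _ _ (dPi_functor A g)). Qed.

Section Unit.
Variables (l h : G) (lh : l + h = 0).

(** Keeping [l] and [h] general makes both orders of [g] and [- g] available. *)
Program Definition PiK X : chain X (Pi_cplx l (Pi_cplx h X)) :=
  @Chain _ _ _ X (Pi_cplx l (Pi_cplx h X)) (fun i => \1%VF) _ _.
Next Obligation.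
move=> X i; split=> [a m|g m]; rewrite !lfunE //=.
by rewrite -addrA lh addr0.
Qed.
Next Obligation. by move=> *; rewrite !lfunE. Qed.

Lemma PiKE X i x : PiK X i x = x. Proof. exact: id_lfunE. Qed.

Lemma diso_PiK X : diso (Qd (PiK X)).
Proof.
apply: diso_bij => i; first by move=> x y; rewrite !PiKE.
by move=> y; exists y; rewrite PiKE.
Qed.

Lemma PiK_natural X Y (e : dhom X Y) :
  dcomp (Qd (PiK Y)) e ~= dcomp (dPi l (dPi h e)) (Qd (PiK X)).
Proof.
apply: (@pm_natural _ _ _ _ (pm_id A) (pm_comp_map (dPi_functor A l) (pm_Pi A h))
  (fun X => Qd (PiK X))).
by move=> {e}X {}Y f; apply: Qd_square => i x; rewrite !PiKE.
Qed.

End Unit.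

Lemma dPi_faithful g X Y (e e' : dhom X Y) : dPi g e ~= dPi g e' -> e ~= e'.
Proof.
move=> E; have [j [jK _]] := diso_PiK (addNr g) Y.
by apply: (dmonoP jK); rewrite !PiK_natural E.
Qed.

(** Transport along an equality of shifts, needed to compare [l + g] with [g + l]. *)
Definition Pi_cast l l' (e : l = l') X : chain (Pi_cplx l X) (Pi_cplx l' X) :=
  ecast j (chain (Pi_cplx l X) (Pi_cplx j X)) e (Defs.cid (Pi_cplx l X)).

Lemma Pi_castE l l' (e : l = l') X i x : Pi_cast e X i x = x.
Proof. by case: _ / e; apply: cidE. Qed.

Lemma diso_Pi_cast l l' (e : l = l') X : diso (Qd (Pi_cast e X)).
Proof.
apply: diso_bij => i; first by move=> x y; rewrite !Pi_castE.
by move=> y; exists y; rewrite Pi_castE.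
Qed.

End Shifts.

(** * Faithfulness and fullness from quasi-inverses *)

Section QuasiInverse.
Variables (k : fieldType) (G : zmodType) (A B : galg k G).
Variables (K : dfunctor A B) (L : dfunctor B A).

Lemma quasi_inverse_faithful : left_quasi_inverse L K ->
  forall X Y (e e' : dhom X Y), dF_map K e ~= dF_map K e' -> e ~= e'.
Proof.
move=> [c [ci cn]] X Y e e' E; have [d [dc _]] := ci Y.
by apply: (dmonoP dc); rewrite !cn E.
Qed.

End QuasiInverse.

(** The preimage is [L u] conjugated by the unit. Its image under [K] agrees with [u] after applying
    [L], by naturality of the unit, and [L] is faithful. *)
Lemma quasi_inverse_full (k : fieldType) (G : zmodType) (A B : galg k G)
    (K : dfunctor A B) (L : dfunctor B A) :
  left_quasi_inverse L K -> left_quasi_inverse K L ->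
  forall X Y (u : dhom (K X) (K Y)), exists e : dhom X Y, dF_map K e ~= u.
Proof.
move=> [c [ci cn]] KL X Y u; have [d [dc cd]] := ci Y.
exists (dcomp d (dcomp (dF_map L u) (c X))).
apply: (quasi_inverse_faithful KL); have [b [_ cb]] := ci X; apply: (depiP cb).
by rewrite -cn dcompKl.
Qed.

Section GradedFunctor.
Variables (k : fieldType) (G : zmodType) (A B : galg k G) (K : dfunctor A B).
Variable xi : forall (g : G) (X : cplx A), dhom (K (Pi_cplx g X)) (Pi_cplx g (K X)).
Hypothesis xi_natural : forall g X Y (e : dhom X Y),
  dcomp (xi g Y) (dF_map K (dPi g e)) ~= dcomp (dPi g (dF_map K e)) (xi g X).
Hypothesis xi0 : forall X, dcomp (Qd (Pi0 (K X))) (xi 0 X) ~= dF_map K (Qd (Pi0 X)).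
Hypothesis xiD : forall h l X,
  dcomp (Qd (PiD l h (K X))) (dcomp (dPi l (xi h X)) (xi l (Pi_cplx h X)))
    ~= dcomp (xi (l + h) X) (dF_map K (Qd (PiD l h X))).

Lemma xi_cast l l' (e : l = l') X :
  dcomp (Qd (Pi_cast e (K X))) (xi l X) ~= dcomp (xi l' X) (dF_map K (Qd (Pi_cast e X))).
Proof. by case: _ / e; rewrite /= dF_id de_comp_id de_id_comp. Qed.

Lemma xi0_iso X l : l = 0 -> diso (xi l X).
Proof.
move=> ->; have [p [pP Pp]] := diso_Pi0 (K X).
have E : xi 0 X ~= dcomp p (dF_map K (Qd (Pi0 X))) by rewrite -xi0 dcompKl.
apply: (diso_equiv (de_sym E)); apply: diso_comp; first by exists (Qd (Pi0 (K X))).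
exact/dF_diso/diso_Pi0.
Qed.

(** Coherence makes the composite of the two transformations an isomorphism; hence the first has a
    left inverse and the second a right inverse. *)
Lemma xi_compose l h X : l + h = 0 -> exists r,
  [/\ dcomp (dcomp r (dPi l (xi h X))) (xi l (Pi_cplx h X)) ~= did _ &
      exists t, dcomp (dPi l (xi h X)) t ~= did _].
Proof.
move=> lh; have : diso (dcomp (xi (l + h) X) (dF_map K (Qd (PiD l h X)))).
  by apply: diso_comp; [apply: xi0_iso | apply/dF_diso/diso_PiD].
move=> /(diso_equiv (de_sym (xiD h l X)))[s [sl sr]].
exists (dcomp s (Qd (PiD l h (K X)))); split; first by rewrite -!de_compA.
have [p [pP Pp]] := diso_PiD l h (K X).
exists (dcomp (xi l (Pi_cplx h X)) (dcomp s (Qd (PiD l h (K X))))).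
apply: (dmonoP pP); rewrite de_comp_id (de_compA (dPi l _)) (de_compA (Qd (PiD l h _))).
exact: dcompKl sr.
Qed.

(** Gradedness supplies only natural transformations; coherence makes them invertible. The pair [g],
    [- g] gives a left inverse and the pair [- g], [g] a right inverse. *)
Lemma xi_iso g X : diso (xi g X).
Proof.
have [b bE] : exists b, dcomp b (xi g X) ~= did _.
  (* This is a left inverse at [Pi_cplx (- g) (Pi_cplx g X)]; naturality carries it over to the
     isomorphic complex [X]. *)
  have [r [rE _]] := @xi_compose g (- g) (Pi_cplx g X) (subrr g).
  set c := Qd (PiK (addNr g) X).
  have [d [dc _]] := dPi_diso g (dF_diso K (diso_PiK (addNr g) X)).
  have [f [fc _]] := dF_diso K (dPi_diso g (diso_PiK (addNr g) X)).
  exists (dcomp f (dcomp (dcomp r (dPi g (xi (- g) (Pi_cplx g X)))) (dPi g (dF_map K c)))).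
  rewrite -de_compA in rE; rewrite -!de_compA -xi_natural (de_compA (dPi g _)).
  by rewrite dcompKl.
(* Here the shift of [xi g X] by [- g] has a right inverse; shifting by [g] brings it back. *)
have [_ [_ [t tE]]] := @xi_compose (- g) g X (addNr g).
have [d [dc cd]] := diso_PiK (subrr g) (Pi_cplx g (K X)).
have [d' [dc' cd']] := diso_PiK (subrr g) (K (Pi_cplx g X)).
apply: (diso_lr bE (c := dcomp d' (dcomp (dPi g t) (Qd (PiK (subrr g) _))))).
apply: (dmonoP dc); rewrite de_comp_id de_compA PiK_natural -de_compA dcompKl //.
by rewrite de_compA -dPi_comp tE dPi_id de_id_comp.
Qed.

Lemma xi_disomorphic g X : disomorphic (K (Pi_cplx g X)) (Pi_cplx g (K X)).
Proof. by exists (xi g X); apply: xi_iso. Qed.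

End GradedFunctor.

(** * The regular module in varying cohomological degrees *)

Section FreeShift.
Variables (k : fieldType) (G : zmodType) (A : galg k G).

Lemma freeKS n i : freeK A (n + 1) (i + 1) = freeK A n i.
Proof. by rewrite /freeK (inj_eq (addIr 1)). Qed.

Definition free_sh_map n i : 'Hom(sh_cplx (cfree A (n + 1)) i, cfree A n i) :=
  sqmap (gsub_freeK A (n + 1) (i + 1)) (gsub_zero _) (gsub_freeK A n i) (gsub_zero _) \1%VF.

Lemma free_sh_mapE n i y :
  sqval (freeK A n i) 0%VS (free_sh_map n i y) = sqval (freeK A (n + 1) (i + 1)) 0%VS y.
Proof.
have inK x : x \in freeK A (n + 1) (i + 1) -> x \in freeK A n i by rewrite freeKS.
apply: etrans (sqproj0K (inK _ (sqval_in y))); congr (sqval _ _ _).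
by rewrite [LHS]comp_lfunE [(\1 \o _)%VF _]comp_lfunE id_lfunE.
Qed.

Program Definition free_sh n : chain (sh_cplx (cfree A (n + 1))) (cfree A n) :=
  @Chain _ _ _ (sh_cplx (cfree A (n + 1))) (cfree A n) (free_sh_map n) _ _.
Next Obligation.
move=> n i; apply: gmor_sqmap => [|x|x _]; first exact: gmor_id.
  by rewrite freeKS id_lfunE.
by rewrite id_lfunE.
Qed.
Next Obligation.
move=> n i y; rewrite [in RHS]zero_lfunE.
by rewrite (_ : diff _ i y = 0) ?linear0 //= opp_lfunE zero_lfunE oppr0.
Qed.

Lemma free_sh_disomorphic n : disomorphic (sh_cplx (cfree A (n + 1))) (cfree A n).
Proof.
exists (Qd (free_sh n)); apply: diso_bij => i => [y y' E|y].
  apply: (can_inj (@sqvalK _ _ _ _ _ _)); rewrite -[LHS]free_sh_mapE -[RHS]free_sh_mapE.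
  by rewrite [free_sh_map n i y]E.
exists (sqproj (freeK A (n + 1) (i + 1)) 0%VS (sqval (freeK A n i) 0%VS y)).
apply: (can_inj (@sqvalK _ _ _ _ _ _)); rewrite [RHS]free_sh_mapE.
by apply/esym/sqproj0K; rewrite freeKS sqval_in.
Qed.

Lemma cfree_eq0 n i (y : cfree A n i) : i != n -> y = 0.
Proof. by move=> ne; rewrite -[y]sqvalK; apply: sqproj0; apply: freeK_neq ne (sqval_in y). Qed.

Lemma stalk_eq0 (M : gmod A) i (x : stalk M i) : i != 0 -> x = 0.
Proof. by move: x => /=; case: eqP => // _ x _; apply: zero_vect0. Qed.

Lemma free_stalk_disomorphic : disomorphic (cfree A 0) (stalk (regular A)).
Proof.
have d1 : diff (stalk (regular A)) 0 (1 : A) = 0 by apply: zero_lfunE.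
have h1 : (1 : A) \in hom_part (stalk (regular A) 0) (- 0).
  by rewrite oppr0; apply: galg_one.
apply: disomorphic_trans (disomorphic_sym _) _.
  by exists (Qd (Pi0 (cfree A 0))); apply: diso_Pi0.
have embK y : emb 0 (sqval (freeK A 0 0) 0%VS y) = y by apply: sqvalK.
have cE y : free_chain d1 h1 0 y = sqval (freeK A 0 0) 0%VS y.
  by rewrite -[in LHS](embK y) free_chainE; apply: mulr1.
exists (Qd (free_chain d1 h1)); apply: diso_bij => i; have [->|ne] := eqVneq i 0.
- by move=> y y'; rewrite !cE => /(can_inj (@sqvalK _ _ _ _ _ _)).
- by move=> y y' _; rewrite (cfree_eq0 y ne) (cfree_eq0 y' ne).
- by move=> y; exists (emb 0 y); rewrite cE sqproj0K // free_in.
- by move=> y; exists 0; rewrite linear0; apply: stalk_eq0.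
Qed.

End FreeShift.

(** * Transport along a graded equivalence *)

(** [K] commutes with the shift up to isomorphism, and the shift moves the regular module by one
    degree; induction over the integers runs in both directions from [0]. *)
Lemma cfree_image_coh_conc (k : fieldType) (G : zmodType) (A B : galg k G)
    (K : dfunctor A B) (m : int) : triangulated K ->
  coh_conc m (K (cfree A 0)) -> forall j, coh_conc (m + j) (K (cfree A j)).
Proof.
move=> [theta [thetai _ _]] K0.
have S j : coh_conc (m + (j + 1)) (K (cfree A (j + 1))) <-> coh_conc (m + j) (K (cfree A j)).
  rewrite addrA -coh_conc_sh.
  have E : disomorphic (sh_cplx (K (cfree A (j + 1)))) (K (cfree A j)).
    apply: disomorphic_trans (dF_disomorphic K (free_sh_disomorphic A j)).
    by apply: disomorphic_sym; exists (theta (cfree A (j + 1))).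
  split; apply: coh_conc_diso => //; exact: disomorphic_sym.
elim/int_rect => [|j IH|j IH]; first by rewrite addr0.
  by rewrite -addn1 PoszD S.
by rewrite -S -addn1 PoszD opprD addrNK.
Qed.

(** * Algebraic identities for the central action *)

Section EtaIdentities.
Variables (k : fieldType) (G : zmodType) (A : galg k G).
Implicit Types (X : cplx A) (x y : fun_alg A).

Lemma hcentral_lin g c x y :
  is_hcentral g x -> is_hcentral g y -> is_hcentral g (c *: x + y).
Proof.
move=> [/asboolP xZ xg] [/asboolP yZ yg]; split=> [|l].
  by apply/asboolP; have [_ H _] := gcentral_subalg A; apply: H.
by have := memvD (memvZ c (xg l)) (yg l).
Qed.

Lemma hcentral_zero g : is_hcentral g (0 : fun_alg A).
Proof. by split=> [l h a _|l]; [rewrite mul0r mulr0 | rewrite mem0v]. Qed.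

Lemma hcentral_one : is_hcentral 0 (1 : fun_alg A).
Proof. by split=> [l h a _|l]; [rewrite mul1r mulr1 | apply: galg_one]. Qed.

Lemma hcentral_mul g h x y :
  is_hcentral g x -> is_hcentral h y -> is_hcentral (g + h) (x * y).
Proof.
move=> [/asboolP xZ xg] [/asboolP yZ yh]; split=> [|l].
  by apply/asboolP; have [_ _ H] := gcentral_subalg A; apply: H.
exact: galg_mul.
Qed.

Lemma eta_irr g x (xh xh' : is_hcentral g x) X : Qd (eta xh X) ~= Qd (eta xh' X).
Proof. exact: chain_eqP. Qed.

Lemma eta_lin g c x y (xh : is_hcentral g x) (yh : is_hcentral g y)
    (xyh : is_hcentral g (c *: x + y)) X :
  Qd (eta xyh X) ~= dadd (dscale c (Qd (eta xh X))) (Qd (eta yh X)).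
Proof.
rewrite -de_Qscale -de_Qadd; apply: chain_eqP => i m.
by rewrite caddE cscaleE; exact: (emul_lin c x y m).
Qed.

Lemma eta_one (h1 : is_hcentral 0 (1 : fun_alg A)) X :
  dcomp (Qd (Pi0 X)) (Qd (eta h1 X)) ~= did X.
Proof. by apply: Qd_eq => i m; rewrite Pi0E cidE; apply: emul_one. Qed.

Lemma eta_mul g h x y (xh : is_hcentral g x) (yh : is_hcentral h y)
    (xyh : is_hcentral (g + h) (x * y)) X :
  Qd (eta xyh X)
    ~= dcomp (Qd (PiD g h X)) (dcomp (Qd (eta xh (Pi_cplx h X))) (Qd (eta yh X))).
Proof.
rewrite -!de_Qcomp; apply: chain_eqP => i m; rewrite !ccompE PiDE.
exact: (emul_mul x m (hcentral_deg yh)).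
Qed.

(** Acting by [x] on the shift by [l] amounts to shifting the action of [tau l x]. The two targets
    carry the shifts in opposite order, which the cast reconciles. *)
Lemma eta_tau g l x (xh : is_hcentral g x) (th : is_hcentral g (tau l x)) X :
  dcomp (Qd (PiD g l X)) (Qd (eta xh (Pi_cplx l X)))
    ~= dcomp (Qd (Pi_cast (addrC l g) X))
             (dcomp (Qd (PiD l g X)) (dPi l (Qd (eta th X)))).
Proof.
rewrite -!de_Qcomp; apply: chain_eqP => i m.
by rewrite !ccompE PiDE Pi_castE PiDE; exact: (@emul_shift _ _ _ l (X i) x m).
Qed.

End EtaIdentities.

Section Transport.
Variables (k : fieldType) (G : zmodType) (A B : galg k G).
Variables (F : dfunctor A B) (F' : dfunctor B A).
Hypotheses (unitF : left_quasi_inverse F' F) (counitF : left_quasi_inverse F F').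
Hypotheses (gF' : graded F') (tF' : triangulated F').
Variable xi : forall (g : G) (X : cplx A), dhom (F (Pi_cplx g X)) (Pi_cplx g (F X)).
Hypothesis xi_natural : forall g X Y (e : dhom X Y),
  dcomp (xi g Y) (dF_map F (dPi g e)) ~= dcomp (dPi g (dF_map F e)) (xi g X).
Hypothesis xi0 : forall X, dcomp (Qd (Pi0 (F X))) (xi 0 X) ~= dF_map F (Qd (Pi0 X)).
Hypothesis xiD : forall h l X,
  dcomp (Qd (PiD l h (F X))) (dcomp (dPi l (xi h X)) (xi l (Pi_cplx h X)))
    ~= dcomp (xi (l + h) X) (dF_map F (Qd (PiD l h X))).
Variables (n m : int).
Hypotheses (Fn : coh_conc n (F (cfree A 0))) (Fm : coh_conc m (F' (cfree B 0))).

Let xiI g X : diso (xi g X) := xi_iso xi_natural xi0 xiD g X.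

(** On these complexes morphisms are detected by cohomology both before applying [F], in degree [0],
    and after it, in degree [n]. *)
Definition testing (X : cplx A) : Prop := coh_conc 0 X /\ coh_conc n (F X).

Lemma testing_Pi g X : testing X -> testing (Pi_cplx g X).
Proof.
move=> [X0 Xn]; split=> //.
apply: coh_conc_diso (disomorphic_sym (xi_disomorphic xi_natural xi0 xiD g X)) _.
exact: coh_conc_Pi.
Qed.

Lemma testing_cfree g : testing (Pi_cplx g (cfree A 0)).
Proof. by apply: testing_Pi; split=> //; exact: (@free_coh_conc _ _ A 0 0). Qed.

Definition transport (g : G) (x : fun_alg A) (y : fun_alg B) : Prop :=
  exists (xh : is_hcentral g x) (yh : is_hcentral g y), forall X, testing X ->
    dcomp (xi g X) (dF_map F (Qd (eta xh X))) ~= Qd (eta yh (F X)).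

(** [F] is full and [xi] invertible, so each component has a preimage; faithfulness transfers
    naturality. The identity holds for every [X], also outside [testing], as the proof of
    [transport_inj_r] requires. *)
Lemma pullback_family g (y : fun_alg B) (yh : is_hcentral g y) :
  exists v : forall X : cplx A, dhom X (Pi_cplx g X),
    (forall X Y (f : chain X Y),
       dcomp (v Y) (Qd f) ~= dcomp (Qd (Pi_chain g f)) (v X)) /\
    forall X, dcomp (xi g X) (dF_map F (v X)) ~= Qd (eta yh (F X)).
Proof.
have vP X : exists v : dhom X (Pi_cplx g X),
    dcomp (xi g X) (dF_map F v) ~= Qd (eta yh (F X)).
  have [z [zx xz]] := xiI g X.
  have [v vE] := quasi_inverse_full unitF counitF (dcomp z (Qd (eta yh (F X)))).
  by exists v; rewrite vE dcompKl.
exists (fun X => sval (boolp.cid (vP X))); split=> [X Y f|X]; last first.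
  exact: (svalP (boolp.cid (vP X))).
move: (sval _) (svalP (boolp.cid (vP X))) => vX EX.
move: (sval _) (svalP (boolp.cid (vP Y))) => vY EY.
have [z [zx _]] := xiI g Y; apply: (quasi_inverse_faithful unitF); apply: (dmonoP zx).
rewrite !dF_comp de_compA EY eta_natural -EX de_compA.
by rewrite -(xi_natural g (Qd f)) -de_compA.
Qed.

Lemma transport_ex_l g y : is_hcentral g y -> exists x, transport g x y.
Proof.
move=> yh; have [v [vn vE]] := pullback_family yh.
have [x [xh xE]] := family_eta 0 vn; exists x, xh, yh => X [X0 _].
by rewrite -xE.
Qed.

Lemma transport_inj_l g x x' y : transport g x y -> transport g x' y -> x = x'.
Proof.
move=> [xh [yh E]] [xh' [yh' E']]; apply: (@eta_inj _ _ _ 0 _ _ _ xh xh') => h.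
have [z [zx _]] := xiI g (Pi_cplx h (cfree A 0)).
apply: (quasi_inverse_faithful unitF); apply: (dmonoP zx).
rewrite (E _ (testing_cfree h)) (E' _ (testing_cfree h)); exact: eta_irr.
Qed.

Lemma transport_ex_r g x : is_hcentral g x -> exists y, transport g x y.
Proof.
move=> xh; have [c [ci cn]] := counitF.
pose d Y := sval (boolp.cid (ci Y)).
have dc Y : dcomp (d Y) (c Y) ~= did Y by have [] := svalP (boolp.cid (ci Y)).
have cd Y : dcomp (c Y) (d Y) ~= did _ by have [] := svalP (boolp.cid (ci Y)).
have [u [un uE]] : exists u : forall X, dhom (F X) (Pi_cplx g (F X)),
    (forall X X' (e : dhom X X'),
       dcomp (u X') (dF_map F e) ~= dcomp (dPi g (dF_map F e)) (u X)) /\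
    (forall X, u X ~= dcomp (xi g X) (dF_map F (Qd (eta xh X)))).
  exists (fun X => dcomp (xi g X) (dF_map F (Qd (eta xh X)))); split=> // X X' e.
  by rewrite -de_compA -dF_comp eta_natural dF_comp !de_compA xi_natural.
(* Conjugation by the counit extends the family from objects [F X] to all complexes. *)
pose w Y := dcomp (dPi g (d Y)) (dcomp (u (F' Y)) (c Y)).
have wn X Y (f : chain X Y) : dcomp (w Y) (Qd f) ~= dcomp (Qd (Pi_chain g f)) (w X).
  have [z [zx _]] := dPi_diso g (ci Y); apply: (dmonoP zx); rewrite /w.
  have H Z : dcomp (dPi g (c Z)) (dPi g (d Z)) ~= did _ by rewrite -dPi_comp cd dPi_id.
  rewrite -[Qd (Pi_chain g f)]/(dPi g (Qd f)) -!de_compA cn dcompKl // (de_compA (u _)) un.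
  by rewrite (de_compA (dPi g (c Y))) -dPi_comp cn dPi_comp -!de_compA dcompKl.
have [y [yh yE]] := family_eta n wn; exists y, xh, yh => X [_ Xn].
rewrite -yE // -uE /w.
(* [u] is known to be natural only along images under [F]; fullness turns [c (F X)] into such an
   image. *)
have [e eE] := quasi_inverse_full unitF counitF (c (F X)).
rewrite -{1}eE un eE de_compA -dPi_comp dc dPi_id de_id_comp.
exact: de_refl.
Qed.

(** The families pulled back to [A] agree on shifts of the regular module, hence on all complexes
    with cohomology in degree [0]. So [y] and [y'] act alike on [F X] for such [X], and these
    include [F'] of suitable free complexes over [B]. *)
Lemma transport_inj_r g x y y' : transport g x y -> transport g x y' -> y = y'.
Proof.
move=> [xh [yh E]] [xh' [yh' E']].
have [v [vn vE]] := pullback_family yh; have [v' [vn' vE']] := pullback_family yh'.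
have [z [zh zE]] := family_eta 0 vn; have [z' [zh' zE']] := family_eta 0 vn'.
have zz' : z = z'.
  apply: (@eta_inj _ _ _ 0 _ _ _ zh zh') => h; have [X0 Xn] := testing_cfree h.
  rewrite -zE // -zE' //; have [s [sx _]] := xiI g (Pi_cplx h (cfree A 0)).
  apply: (quasi_inverse_faithful unitF); apply: (dmonoP sx).
  rewrite vE vE' -(E _ (testing_cfree h)) -(E' _ (testing_cfree h)).
  by rewrite (eta_irr xh xh').
have vv' X : coh_conc 0 X -> Qd (eta yh (F X)) ~= Qd (eta yh' (F X)).
  move=> X0; rewrite -vE -vE' zE // zE' //.
  by case: _ / zz' zh' zE' => zh' _; rewrite (eta_irr zh zh').
(* The degree [- m] is chosen because [F'] sends the regular module there to cohomological degree
   [m + (- m) = 0], within reach of [vv']. *)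
apply: (@eta_inj _ _ _ (- m) _ _ _ yh yh') => h; set Y := Pi_cplx h _.
have [c [ci cn]] := counitF; have [s [sc _]] := dPi_diso g (ci Y).
apply: (dmonoP sc); rewrite -!eta_natural vv' //.
have [xi' [nat' zero' D']] := gF'.
apply: coh_conc_diso (disomorphic_sym (xi_disomorphic nat' zero' D' h _)) _.
apply: coh_conc_Pi; have := cfree_image_coh_conc tF' Fm (j := - m).
by rewrite subrr.
Qed.

Lemma transport_lin g c x x' y y' :
  transport g x y -> transport g x' y' -> transport g (c *: x + x') (c *: y + y').
Proof.
move=> [xh [yh E]] [xh' [yh' E']].
exists (hcentral_lin c xh xh'), (hcentral_lin c yh yh') => X tX.
rewrite (eta_lin xh xh') (eta_lin yh yh') dF_add dF_scale.
by rewrite de_compDr de_compZr E // E'.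
Qed.

Lemma transport_one : transport 0 1 1.
Proof.
exists (hcentral_one A), (hcentral_one B) => X _; have [p [pP Pp]] := diso_Pi0 (F X).
apply: (dmonoP pP); rewrite de_compA xi0 -dF_comp !eta_one.
exact: dF_id.
Qed.

(** Coherence splits the product: [x'] acts on [X], and [x] on its shift by [h], which is again a
    test object. *)
Lemma transport_mul g h x x' y y' :
  transport g x y -> transport h x' y' -> transport (g + h) (x * x') (y * y').
Proof.
move=> [xh [yh E]] [xh' [yh' E']].
exists (hcentral_mul xh xh'), (hcentral_mul yh yh') => X tX.
rewrite (eta_mul xh xh') (eta_mul yh yh') !dF_comp de_compA -xiD -!de_compA.
rewrite (de_compA (xi g _)) (E _ (testing_Pi h tX)) (de_compA (dPi g _)).
by rewrite -eta_natural -de_compA E'.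
Qed.

(** The claim is shifted by [l], which is faithful. By [eta_tau] it then concerns [x] on the shift
    of [X], again a test object; coherence of [xi] is used for both orders of the shifts. *)
Lemma transport_tau g l x y : transport g x y -> transport g (tau l x) (tau l y).
Proof.
move=> [xh [yh E]]; exists (tau_hcentral l xh), (tau_hcentral l yh) => X tX.
have [z [_ xz]] := xiI l X.
have [p [pP _]] := diso_PiD l g (F X).
have [c [cC _]] := diso_Pi_cast (addrC l g) (F X).
apply: (dPi_faithful (g := l)); apply: (depiP xz); apply: (dmonoP pP); apply: (dmonoP cC).
rewrite dPi_comp -de_compA -xi_natural (de_compA (dPi l _)) (de_compA (Qd (PiD l g _))) xiD.
rewrite -!de_compA -!dF_comp (de_compA _ (xi _ _)) xi_cast -de_compA -dF_comp.
rewrite -(eta_tau xh) dF_comp de_compA -xiD -!de_compA (E _ (testing_Pi l tX)).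
rewrite -eta_natural !de_compA (eta_tau yh (tau_hcentral l yh)).
by rewrite -!de_compA.
Qed.

End Transport.

(** * The isomorphism of graded centres *)

Section Components.
Variables (k : fieldType) (G : zmodType) (A : galg k G).
Implicit Types (x y : fun_alg A) (g h l : G).

Lemma gpr_mulr g h (a b : A) : b \in ahom_part A h ->
  gpr (galg_grading A) (g + h) (a * b) = gpr (galg_grading A) g a * b.
Proof.
move=> bh; have [s [_ sE _]] := gpr_sum (galg_grading A).
rewrite -{1}(sE a) mulr_suml linear_sum -{2}(sE a) linear_sum mulr_suml.
apply: eq_bigr => l _; set c := gpr _ l a.
have cl : c \in ahom_part A l by apply: gpr_in.
have cb := galg_mul cl bh; have [lg|ne] := eqVneq l g.
  by rewrite -lg; apply: etrans (gpr_id _ cb) (congr1 ( *%R^~ b) (esym (gpr_id _ cl))).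
apply: etrans (gpr_neq _ cb _) _; first by rewrite (inj_eq (addIr h)).
by apply: etrans (esym (mul0r b)) (congr1 ( *%R^~ b) (esym (gpr_neq _ cl ne))).
Qed.

Lemma gpr_mull g h (a b : A) : b \in ahom_part A h ->
  gpr (galg_grading A) (g + h) (b * a) = b * gpr (galg_grading A) g a.
Proof.
move=> bh; have [s [_ sE _]] := gpr_sum (galg_grading A).
rewrite -{1}(sE a) mulr_sumr linear_sum -{2}(sE a) linear_sum mulr_sumr.
apply: eq_bigr => l _; set c := gpr _ l a.
have cl : c \in ahom_part A l by apply: gpr_in.
have cb := galg_mul bh cl; rewrite addrC in cb; have [lg|ne] := eqVneq l g.
  by rewrite -lg; apply: etrans (gpr_id _ cb) (congr1 ( *%R b) (esym (gpr_id _ cl))).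
apply: etrans (gpr_neq _ cb _) _; first by rewrite (inj_eq (addIr h)).
by apply: etrans (esym (mulr0 b)) (congr1 ( *%R b) (esym (gpr_neq _ cl ne))).
Qed.

Definition hcomp g x : fun_alg A := fun l => gpr (galg_grading A) g (x l).

(** For [a] of degree [h], compare the components of degree [g + h] in the centrality relation. *)
Lemma hcomp_hcentral g x : is_gcentral x -> is_hcentral g (hcomp g x).
Proof.
move=> xZ; split=> [l h a ah|l]; last exact: gpr_in.
by rewrite /hcomp -(gpr_mulr _ _ ah) -(gpr_mull _ _ ah) (xZ _ _ _ ah).
Qed.

Lemma hcomp_lin g c x y : hcomp g (c *: x + y) = c *: hcomp g x + hcomp g y.
Proof. by apply/funext => l; apply: linearP. Qed.

Lemma hcomp_zero g : hcomp g 0 = 0.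
Proof. by apply/funext => l; apply: linear0. Qed.

Lemma hcomp_sum g (I : Type) (r : seq I) (E : I -> fun_alg A) :
  hcomp g (\sum_(i <- r) E i) = \sum_(i <- r) hcomp g (E i).
Proof.
apply: (big_morph (hcomp g)) => [x y|]; last exact: hcomp_zero.
by have := hcomp_lin g 1 x y; rewrite !scale1r.
Qed.

Lemma hcomp_id g x : is_hcentral g x -> hcomp g x = x.
Proof. by move=> [_ xg]; apply/funext => l; apply/gpr_id/xg. Qed.

Lemma hcomp_neq g h x : is_hcentral g x -> g != h -> hcomp h x = 0.
Proof. by move=> [_ xg] gh; apply/funext => l; apply: (gpr_neq _ (xg l) gh). Qed.

Lemma hcomp_inj x y : (forall g, hcomp g x = hcomp g y) -> x = y.
Proof.
move=> E; apply/funext => l; have [s [_ sE _]] := gpr_sum (galg_grading A).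
rewrite -(sE (x l)) -(sE (y l)); apply: eq_bigr => g _.
exact: (congr1 (fun z => z l) (E g)).
Qed.

Lemma hcomp_support : exists s : seq G, forall g x, g \notin s -> hcomp g x = 0.
Proof.
have [s [_ _ s0]] := gpr_sum (galg_grading A); exists s => g x gs.
by apply/funext => l; apply: s0.
Qed.

Lemma hcomp_decompose (s : seq G) x : uniq s ->
  (forall g y, g \notin s -> hcomp g y = 0) -> \sum_(g <- s) hcomp g x = x.
Proof.
move=> us s0; apply: hcomp_inj => h; rewrite hcomp_sum.
have E g : hcomp h (hcomp g x) = if h == g then hcomp g x else 0.
  by apply/funext => l; rewrite /hcomp gpr_gpr; case: eqP.
rewrite (eq_bigr _ (fun g _ => E g)); case hs: (h \in s).
  rewrite (bigD1_seq h) //= eqxx big1 ?addr0 // => g /negPf.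
  by rewrite eq_sym => ->.
rewrite (s0 _ _ (negbT hs)) big_seq big1 // => g gs.
by case: eqP gs => // <-; rewrite hs.
Qed.

Lemma hcomp_mul (s : seq G) g x y : uniq s ->
  (forall h z, h \notin s -> hcomp h z = 0) ->
  hcomp g (x * y) = \sum_(h <- s) hcomp h x * hcomp (g - h) y.
Proof.
move=> us s0; rewrite -{1}(hcomp_decompose x us s0) mulr_suml hcomp_sum.
apply: eq_bigr => h _; apply/funext => l.
have xh : hcomp h x l \in ahom_part A h by apply: gpr_in.
by have := gpr_mull (g - h) (y l) xh; rewrite subrK.
Qed.

Lemma gcentral_big (s : seq G) (E : G -> fun_alg A) :
  (forall g, is_gcentral (E g)) -> is_gcentral (\sum_(g <- s) E g).
Proof.
move=> EZ; elim/big_rec: _ => [|g x _ xZ]; first exact: hcentral_gcentral (hcentral_zero A 0).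
have [_ H _] := gcentral_subalg A; apply/asboolP.
by have := H 1 (E g) x (asboolT (EZ g)) (asboolT xZ); rewrite scale1r.
Qed.

Lemma hcomp_deg g x : (forall l, x l \in ahom_part A g) <-> forall h, h != g -> hcomp h x = 0.
Proof.
split=> [xg h hg|x0 l].
  by apply/funext => l; apply: (gpr_neq _ (xg l)); rewrite eq_sym.
apply: (gpr_hom (gV := galg_grading A)) => h hg.
exact: (congr1 (fun z => z l) (x0 h hg)).
Qed.

(** An eigenvector condition for all translations, and thus a form of the character condition that a
    correspondence respects. *)
Lemma gcentre_charP (chi : gchar k G) (u : gcentre A) :
  gcentre_char A chi u <-> forall l, tau l (gcentre_val u) = chi l *: gcentre_val u.
Proof.
split=> [uc l|uc l].
  apply/funext => j; rewrite /tau uc gcharD mulrC -scalerA -uc.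
  by [].
by have := congr1 (fun z : fun_alg A => z 0) (uc l); rewrite /tau add0r.
Qed.

End Components.

(** One direction of an isomorphism on homogeneous elements; the other is the same record for the
    flipped relation. *)
Record correspondence (k : fieldType) (G : zmodType) (A B : galg k G)
    (T : G -> fun_alg A -> fun_alg B -> Prop) : Prop := Correspondence {
  corr_hr : forall g x y, T g x y -> is_hcentral g y;
  corr_ex : forall g x, is_hcentral g x -> exists y, T g x y;
  corr_inj : forall g x y y', T g x y -> T g x y' -> y = y';
  corr_lin : forall g c x x' y y', T g x y -> T g x' y' ->
    T g (c *: x + x') (c *: y + y');
  corr_one : T 0 1 1;
  corr_mul : forall g h x x' y y', T g x y -> T h x' y' -> T (g + h) (x * x') (y * y');
  corr_tau : forall g l x y, T g x y -> T g (tau l x) (tau l y)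
}.

(** * From homogeneous elements to the whole graded centre *)

Section Total.
Variables (k : fieldType) (G : zmodType) (A B : galg k G).
Variable T : G -> fun_alg A -> fun_alg B -> Prop.
Hypothesis TP : correspondence T.

Definition total (x : fun_alg A) (y : fun_alg B) := forall g, T g (hcomp g x) (hcomp g y).

Lemma corr_zero g : T g 0 0.
Proof.
have [y xy] := corr_ex TP (hcentral_zero A g).
by have := corr_lin TP (- 1) xy xy; rewrite !scaleN1r !addNr.
Qed.

Lemma corr_sum g (s : seq G) E E' : (forall h, T g (E h) (E' h)) ->
  T g (\sum_(h <- s) E h) (\sum_(h <- s) E' h).
Proof.
move=> EE'; elim/big_ind2: _ => [|x y x' y' xy xy'|//]; first exact: corr_zero.
by have := corr_lin TP 1 xy xy'; rewrite !scale1r.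
Qed.

(** Partners of the components in a finite support are added up; each is homogeneous, so the sum has
    them as its components. *)
Lemma total_ex x : is_gcentral x -> exists y, is_gcentral y /\ total x y.
Proof.
move=> xZ; have /choice[e eP] g := corr_ex TP (hcomp_hcentral g xZ).
have eh g := corr_hr TP (eP g).
have [s s0] := hcomp_support A; exists (\sum_(g <- undup s) e g); split.
  by apply: gcentral_big => g; apply: hcentral_gcentral (eh g).
move=> g; rewrite hcomp_sum; case gs: (g \in undup s).
  rewrite (bigD1_seq g) ?undup_uniq //= (hcomp_id (eh g)) big1 ?addr0 // => h.
  by move=> hg; apply: hcomp_neq (eh h) hg.
have -> : \sum_(h <- undup s) hcomp g (e h) = 0.
  rewrite big_seq big1 // => h hs; apply: hcomp_neq (eh h) _.
  by apply: contraFneq gs => <-.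
rewrite s0; first exact: corr_zero.
by rewrite -mem_undup gs.
Qed.

Lemma total_inj x y y' : total x y -> total x y' -> y = y'.
Proof. by move=> xy xy'; apply: hcomp_inj => g; apply: corr_inj TP _ _ _ _ (xy g) (xy' g). Qed.

Lemma total_lin c x x' y y' : total x y -> total x' y' -> total (c *: x + x') (c *: y + y').
Proof. by move=> xy xy' g; rewrite !hcomp_lin; apply: corr_lin. Qed.

Lemma total_scale c x y : total x y -> total (c *: x) (c *: y).
Proof.
have z : total 0 0 by move=> g; rewrite !hcomp_zero; apply: corr_zero.
by move=> xy; have := total_lin c xy z; rewrite !addr0.
Qed.

Lemma total_one : total 1 1.
Proof.
have one C : @is_hcentral k G C 0 1 := hcentral_one C.
move=> g; have [<-|ne] := eqVneq 0 g.
  by rewrite (hcomp_id (one A)) (hcomp_id (one B)); apply: corr_one.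
rewrite (hcomp_neq (one A) ne) (hcomp_neq (one B) ne); exact: corr_zero.
Qed.

Lemma total_mul x x' y y' : total x y -> total x' y' -> total (x * x') (y * y').
Proof.
move=> xy xy' g; have [s s0] := hcomp_support A; have [t t0] := hcomp_support B.
have u : uniq (undup (s ++ t)) by apply: undup_uniq.
rewrite (hcomp_mul g x x' u) => [|h z]; last first.
  by rewrite mem_undup mem_cat negb_or => /andP[/s0].
rewrite (hcomp_mul g y y' u) => [|h z]; last first.
  by rewrite mem_undup mem_cat negb_or => /andP[_ /t0].
apply: corr_sum => h; have := corr_mul TP (xy h) (xy' (g - h)).
by rewrite addrCA subrr addr0.
Qed.

Lemma total_tau l x y : total x y -> total (tau l x) (tau l y).
Proof. by move=> xy g; apply: (corr_tau TP l (xy g)). Qed.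

Lemma total_deg g x y : total x y ->
  (forall l, x l \in ahom_part A g) -> forall l, y l \in ahom_part B g.
Proof.
move=> xy /hcomp_deg x0; apply/hcomp_deg => h hg.
have := xy h; rewrite x0 // => Th; exact: corr_inj TP _ _ _ _ Th (corr_zero h).
Qed.

Lemma total_char (chi : gchar k G) (u : gcentre A) (v : gcentre B) :
  total (gcentre_val u) (gcentre_val v) -> gcentre_char A chi u -> gcentre_char B chi v.
Proof.
move=> uv /gcentre_charP uc; apply/gcentre_charP => l.
apply: total_inj (total_tau l uv) _; rewrite uc; exact: total_scale.
Qed.

End Total.

(** Choice gives functions in both directions. Uniqueness of partners makes them mutually inverse
    and turns the compatibilities of the relation into linearity and multiplicativity. *)
Lemma correspondence_iso (k : fieldType) (G : zmodType) (A B : galg k G)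
    (T : G -> fun_alg A -> fun_alg B -> Prop) :
  correspondence T -> correspondence (fun g y x => T g x y) ->
  exists f : {lrmorphism gcentre A -> gcentre B},
    [/\ bijective f,
        forall g : G, f @` gcentre_deg A g = gcentre_deg B g &
        forall (g : G) (chi : gchar k G),
          f @` (gcentre_deg A g `&` gcentre_char A chi)
            = gcentre_deg B g `&` gcentre_char B chi].
Proof.
move=> TP TP'.
have flip x y : total (fun g y x => T g x y) y x <-> total T x y by [].
have /choice[f fP] (u : gcentre A) : exists v : gcentre B,
    total T (gcentre_val u) (gcentre_val v).
  have /asboolP uZ := gcentre_valP u; have [y [yZ uy]] := total_ex TP uZ.
  by exists (GCentre (asboolT yZ)).
have /choice[f' fP'] (v : gcentre B) : exists u : gcentre A,
    total T (gcentre_val u) (gcentre_val v).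
  have /asboolP vZ := gcentre_valP v; have [x [xZ vx]] := total_ex TP' vZ.
  by exists (GCentre (asboolT xZ)).
have f_inj u v v' : total T (gcentre_val u) (gcentre_val v) ->
    total T (gcentre_val u) (gcentre_val v') -> v = v' :> gcentre B.
  by move=> uv uv'; apply: val_inj; apply: (total_inj TP uv uv').
have f_inj' u u' v : total T (gcentre_val u) (gcentre_val v) ->
    total T (gcentre_val u') (gcentre_val v) -> u = u' :> gcentre A.
  by move=> uv uv'; apply: val_inj; apply: (total_inj TP' (y := gcentre_val u)).
have f_lin : linear f.
  move=> c u u'; exact: (@f_inj _ _ (c *: f u + f u') (fP (c *: u + u'))
    (total_lin TP c (fP u) (fP u'))).
have f_mul : monoid_morphism f.
  split; first exact: (@f_inj 1 (f 1) 1 (fP 1) (total_one TP)).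
  move=> u u'; exact: (@f_inj _ _ (f u * f u') (fP (u * u')) (total_mul TP (fP u) (fP u'))).
pose fl := GRing.isLinear.Build k (gcentre A) (gcentre B) *:%R f f_lin.
pose fm := GRing.isMonoidMorphism.Build (gcentre A) (gcentre B) f f_mul.
pose F : {lrmorphism gcentre A -> gcentre B} := HB.pack f fl fm.
have deg g u : gcentre_deg A g u <-> gcentre_deg B g (f u).
  by split; [apply: (total_deg TP (fP u)) | apply: (total_deg TP' (fP u))].
have char chi u : gcentre_char A chi u <-> gcentre_char B chi (f u).
  by split; [apply: (total_char TP (fP u)) | apply: (total_char TP' (fP u))].
have fK : cancel f f' by move=> u; apply: f_inj' (fP' _) (fP _).
have fK' : cancel f' f by move=> v; apply: f_inj (fP _) (fP' _).
exists F; split; first by exists f'.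
  move=> g; apply/seteqP; split=> [_ [u /deg ug <-]//|v vg].
  by exists (f' v); [apply/deg; rewrite fK' | apply: fK'].
move=> g chi; apply/seteqP; split=> [_ [u [/deg ug /char uc] <-]//|v [vg vc]].
by exists (f' v); [split; [apply/deg|apply/char]; rewrite fK' | apply: fK'].
Qed.

Theorem theorem41 (k : closedFieldType) (G : zmodType) (A B : galg k G) :
  strongly_gradable_derived_equivalent A B ->
  exists f : {lrmorphism gcentre A -> gcentre B},
    [/\ bijective f,
        forall g : G, f @` gcentre_deg A g = gcentre_deg B g &
        forall (g : G) (chi : gchar k G),
          f @` (gcentre_deg A g `&` gcentre_char A chi)
            = gcentre_deg B g `&` gcentre_char B chi].
Proof.
move=> [F [F' [[[xi [xn x0 xD]] _ gF' tF' un co] oF oF']]].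
have [n Fn'] := one_degree_coh_conc oF; have [m Fm'] := one_degree_coh_conc oF'.
(* Strongness speaks of [stalk], the transport of [cfree]; the two complexes are isomorphic. *)
have stalkF C D (K : dfunctor C D) j : coh_conc j (K (stalk (regular C))) ->
    coh_conc j (K (cfree C 0)).
  apply: coh_conc_diso; apply/dF_disomorphic/disomorphic_sym.
  exact: free_stalk_disomorphic.
have Fn := stalkF _ _ _ _ _ _ Fn'; have Fm := stalkF _ _ _ _ _ _ Fm'.
(* Existence and uniqueness have separate arguments in the two directions; the algebraic
   compatibilities serve both. *)
apply: (@correspondence_iso _ _ _ _ (transport xi n)).
  split.
  - by move=> g x y [_ [yh _]].
  - by move=> g x; apply: (transport_ex_r un co xn).
  - move=> g x y y'; exact: (transport_inj_r un co gF' tF' xn x0 xD Fn Fm).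
  - by move=> *; apply: transport_lin.
  - exact: transport_one.
  - by move=> *; apply: (transport_mul xn x0 xD).
  - by move=> *; apply: (transport_tau xn x0 xD).
split.
- by move=> g x y [xh _].
- by move=> g y; apply: (transport_ex_l un co xn x0 xD).
- by move=> g x y y'; apply: (transport_inj_l un xn x0 xD Fn).
- by move=> *; apply: transport_lin.
- exact: transport_one.
- by move=> *; apply: (transport_mul xn x0 xD).
- by move=> *; apply: (transport_tau xn x0 xD).
Qed.
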